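(* Suppose that: (i) $\mathcal{A}$, with domain $D(\mathcal{A})$, generates a strongly continuous semigroup $\mathcal{T}(t)$ on $\mathbb{X}$; (ii) $\mathcal{F}:\mathbb{X}\to\mathbb{X}$ satisfies $\mathcal{F}(0)=0$ and is locally Lipschitz continuous, i.e. for every $\delta>0$ there is $L_{\mathcal{F}\delta}>0$ such that $\|\mathcal{F}(x_2)-\mathcal{F}(x_1)\|\le L_{\mathcal{F}\delta}\|x_2-x_1\|$ whenever $\|x_1\|\le\delta$ and $\|x_2\|\le\delta$; (iii) for each $r\in K_{ad}$, $\mathcal{B}(r):\mathbb{U}\to\mathbb{X}$ is a bounded linear operator, and there is $M_{\mathcal{B}}>0$ with $\|\mathcal{B}(r)\|_{\mathcal{L}(\mathbb{U},\mathbb{X})}\le M_{\mathcal{B}}$ for all $r\in K_{ad}$. Then for each $x_0\in\mathbb{X}$ and each positive number $R$ there exists $\tau>0$ such that the initial value problem $$\dot{x}(t)=\mathcal{A}x(t)+\mathcal{F}(x(t))+\mathcal{B}(r)u(t),\qquad x(0)=x_0,$$ admits a unique local mild solution $x\in C(0,\tau;\mathbb{X})$ for all $u\in U_{ad}=\{u\in L^p(0,\tau;\mathbb{U}) : \|u\|_{L^p(0,\tau;\mathbb{U})}\le R\}$ and all $r\in K_{ad}$.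
   Context: $\mathbb{X}$ (state space) is a separable reflexive Banach space with norm $\|\cdot\|$; $\mathbb{U}$ (input space) is a reflexive Banach space; $K_{ad}$ is a set in a topological space $\mathbb{K}$; $1<p<\infty$. $C(0,\tau;\mathbb{X})$ denotes $C([0,\tau];\mathbb{X})$. A mild solution of the initial value problem on $[0,\tau]$ is a function $x\in C(0,\tau;\mathbb{X})$ satisfying, for $t\in[0,\tau]$, $$x(t)=\mathcal{T}(t)x_0+\int_0^t\mathcal{T}(t-s)\mathcal{F}(x(s))\,ds+\int_0^t\mathcal{T}(t-s)\mathcal{B}(r)u(s)\,ds.$$ *)

(* Defs.v *)
From HB Require Import structures.
From mathcomp Require Import all_boot all_order all_algebra.
From mathcomp Require Import all_classical all_reals all_analysis.

Set Implicit Arguments.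
Unset Strict Implicit.
Unset Printing Implicit Defensive.
Import Order.TTheory GRing.Theory Num.Theory.
Import numFieldNormedType.Exports.

Local Open Scope classical_set_scope.
Local Open Scope ring_scope.

Definition separable_space (T : topologicalType) : Prop :=
  exists D : set T, countable D /\ dense D.

Definition bounded_linear (R : realType) (V W : normedModType R)
    (f : V -> W) : Prop :=
  linear f /\ bounded_fun_norm f.

(* Meaningful for bounded linear [f] only: [sup] is 0 on unbounded sets. *)
Definition opnorm (R : realType) (V W : normedModType R) (f : V -> W) : R :=
  sup [set `|f x| | x in [set x | `|x| <= 1]].

Definition dual (R : realType) (V : normedModType R) : set (V -> R^o) :=
  [set f | bounded_linear f].

(* The dual is a set of functions, not a type, so an element of the bidual is
   a map on all functions [V -> R], of which only the restriction to the dual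
   (normed by [opnorm]) matters. *)
Definition bidual (R : realType) (V : normedModType R) :
    set ((V -> R^o) -> R) :=
  [set phi |
    (forall a f g, dual f -> dual g ->
       phi (fun x => a *: f x + g x) = a * phi f + phi g) /\
    (exists M, forall f, dual f -> `|phi f| <= M * opnorm f)].

(* Surjectivity of the canonical embedding into the bidual. *)
Definition reflexive_space (R : realType) (V : normedModType R) : Prop :=
  forall phi, @bidual R V phi ->
    exists x : V, forall f, dual f -> phi f = f x.

Definition C0_semigroup (R : realType) (X : normedModType R)
    (T : R -> X -> X) : Prop :=
  [/\ forall t, 0 <= t -> bounded_linear (T t),
      T 0 = id,
      forall s t, 0 <= s -> 0 <= t -> T (s + t) = T s \o T t
    & forall x, T t x @[t --> 0^'+] --> x].

(* An unbounded operator is a total function [A] of which only the values on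
   the domain [DA] are relevant. *)
Definition generates (R : realType) (X : normedModType R)
    (DA : set X) (A : X -> X) (T : R -> X -> X) : Prop :=
  [/\ C0_semigroup T,
      DA = [set x | cvg (h^-1 *: (T h x - x) @[h --> 0^'+])]
    & forall x, DA x -> h^-1 *: (T h x - x) @[h --> 0^'+] --> A x].

Definition locally_lipschitz (R : realType) (X : normedModType R)
    (F : X -> X) : Prop :=
  forall delta : R, 0 < delta -> exists L : R, 0 < L /\
    forall x1 x2, `|x1| <= delta -> `|x2| <= delta ->
      `|F x2 - F x1| <= L * `|x2 - x1|.

Definition measurable_simple (d : measure_display) (T : measurableType d)
    (R : realType) (V : normedModType R) (s : {fimfun T >-> V}) : Prop :=
  forall y : V, measurable (s @^-1` [set y]).

Definition strongly_measurable (d : measure_display) (T : measurableType d)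
    (R : realType) (mu : {measure set T -> \bar R}) (V : normedModType R)
    (D : set T) (f : T -> V) : Prop :=
  exists s : nat -> {fimfun T >-> V},
    (forall n, measurable_simple (s n)) /\
    {ae mu, forall t, D t -> s n t @[n --> \oo] --> f t}.

Definition integrable_simple (d : measure_display) (T : measurableType d)
    (R : realType) (mu : {measure set T -> \bar R}) (V : normedModType R)
    (D : set T) (s : {fimfun T >-> V}) : Prop :=
  measurable_simple s /\
  forall y : V, y != 0 -> (mu (D `&` s @^-1` [set y]) < +oo)%E.

Definition simple_integral (d : measure_display) (T : measurableType d)
    (R : realType) (mu : {measure set T -> \bar R}) (V : normedModType R)
    (D : set T) (s : {fimfun T >-> V}) : V :=
  \sum_(y \in range s) fine (mu (D `&` s @^-1` [set y])) *: y.

Definition is_bochner_integral (d : measure_display) (T : measurableType d)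
    (R : realType) (mu : {measure set T -> \bar R}) (V : normedModType R)
    (D : set T) (f : T -> V) (I : V) : Prop :=
  strongly_measurable mu D f /\
  exists s : nat -> {fimfun T >-> V},
    [/\ forall n, integrable_simple mu D (s n),
        (\int[mu]_(t in D) (`|f t - s n t|)%:E)%E @[n --> \oo] --> 0%E
      & simple_integral mu D (s n) @[n --> \oo] --> I].

Definition bochner_integrable (d : measure_display) (T : measurableType d)
    (R : realType) (mu : {measure set T -> \bar R}) (V : normedModType R)
    (D : set T) (f : T -> V) : Prop :=
  exists I : V, is_bochner_integral mu D f I.

(* Equal to 0 when [f] is not Bochner integrable. *)
Definition bochner_integral (d : measure_display) (T : measurableType d)
    (R : realType) (mu : {measure set T -> \bar R}) (V : normedModType R)
    (D : set T) (f : T -> V) : V :=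
  xget 0 [set I | is_bochner_integral mu D f I].

Definition Lp_norm (R : realType) (V : normedModType R) (p tau : R)
    (u : R -> V) : \bar R :=
  ((\int[lebesgue_measure]_(t in `[0%R, tau]) (`|u t| `^ p)%:E) `^ p^-1)%E.

(* Elements of L^p(0, tau; V) are represented by functions on the whole line,
   not by almost-everywhere classes; values outside [0, tau] are irrelevant. *)
Definition Lp_space (R : realType) (V : normedModType R) (p tau : R) :
    set (R -> V) :=
  [set u | strongly_measurable lebesgue_measure `[0, tau] u /\
           (Lp_norm p tau u < +oo)%E].

Definition U_ad (R : realType) (U : normedModType R) (p tau rho : R) :
    set (R -> U) :=
  [set u | Lp_space p tau u /\ (Lp_norm p tau u <= rho%:E)%E].

(* [T] is the semigroup of the linear part, [F] the nonlinearity and [b] the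
   input operator; only the values of [x] and [u] on [0, tau] are relevant. *)
Definition mild_solution (R : realType) (X U : normedModType R)
    (T : R -> X -> X) (F : X -> X) (b : U -> X) (u : R -> U) (x0 : X)
    (tau : R) (x : R -> X) : Prop :=
  {within `[0, tau], continuous x} /\
  forall t : R, 0 <= t <= tau ->
    [/\ bochner_integrable lebesgue_measure `[0, t]
          (fun s => T (t - s) (F (x s))),
        bochner_integrable lebesgue_measure `[0, t]
          (fun s => T (t - s) (b (u s)))
      & x t = T t x0
              + bochner_integral lebesgue_measure `[0, t]
                  (fun s => T (t - s) (F (x s)))
              + bochner_integral lebesgue_measure `[0, t]
                  (fun s => T (t - s) (b (u s)))].

(* Main.v *)
(* The mild solution is the fixed point of the Volterra map
   [x |-> T(t) x0 + int_0^t T(t-s) F(x(s)) ds + int_0^t T(t-s) B(r) u(s) ds].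
   On [0, d] the semigroup is bounded by some M (uniform boundedness principle),
   and on bounded sets F has a Lipschitz constant L.  By Young's inequality the
   L^1(0, tau) norms of the functions of the ball of radius rho of L^p(0, tau)
   tend to 0 uniformly as tau -> 0, so that for tau small, uniformly in u and r,
   the Volterra map sends a ball of C(0, tau; X) to itself and is a contraction
   there.  A second mild solution may leave that ball, but it is bounded, and
   comparison on successive intervals of length 1/(2ML), L being the Lipschitz
   constant on a larger ball, shows that the two coincide.

   Lebesgue measure lives here on the Borel sets, so strongly measurable
   functions need not be measurable and the integrals of their norms are lower
   integrals; these are compared after a modification on a Borel null set. *)
From HB Require Import structures.
Require Import Defs.
From mathcomp Require Import all_boot all_order all_algebra.
From mathcomp Require Import all_classical all_reals all_analysis.
From mathcomp Require Import measurable_realfun ring lra.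

Set Implicit Arguments.
Unset Strict Implicit.
Unset Printing Implicit Defensive.
Import Order.TTheory GRing.Theory Num.Theory.
Import numFieldNormedType.Exports.

Local Open Scope classical_set_scope.
Local Open Scope ring_scope.

(** * Simple functions and lower integrals *)

Section lower_integral.
Context d (T : measurableType d) (R : realType).
Variable mu : {measure set T -> \bar R}.
Import HBNNSimple.

(** The integral of a nonnegative function is the supremum of the integrals of the simple functions
    below it. Setting such a function to 0 on [N] keeps its integral and brings it below [g]; so [f]
    and [g] may be arbitrary. *)
Lemma ge0_le_integral_ae (D N : set T) (f g : T -> \bar R) :
  measurable N -> mu N = 0%E ->
  (forall x, D x -> (0 <= f x)%E) -> (forall x, D x -> (0 <= g x)%E) ->
  (forall x, D x -> ~ N x -> (f x <= g x)%E) ->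
  (\int[mu]_(x in D) f x <= \int[mu]_(x in D) g x)%E.
Proof.
move=> mN N0 f0 g0 fg; rewrite !ge0_integralE//.
apply: ge_ereal_sup => _ [h /= hf <-].
have mNC : measurable (~` N) by exact: measurableC.
have -> : sintegral mu h = sintegral mu (proj_nnsfun h mNC).
  rewrite -!integralT_nnsfun.
  rewrite (ge0_negligible_integral mN)//=; last 2 first.
  - by apply/measurable_EFinP; exact: measurable_funP.
  - by move=> x _; rewrite lee_fin; exact: fun_ge0.
  rewrite integral_mkcond; apply: eq_integral => x _ /=.
  rewrite patchE setTD mindicE.
  by case: ifPn => _; rewrite ?mulr1 ?mulr0.
apply: ereal_sup_ubound; exists (proj_nnsfun h mNC) => // x /=.
rewrite mindicE; have [|xN] := boolP (x \in ~` N); last first.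
  rewrite mulr0 patchE; case: ifPn => // /[!inE]; exact: g0.
rewrite inE mulr1 => /= xN; apply: le_trans (hf x) _.
by rewrite !patchE; case: ifPn => // /[!inE] Dx; exact: fg.
Qed.

Lemma ge0_le_integral_nomeas (D : set T) (f g : T -> \bar R) :
  (forall x, D x -> (0 <= f x)%E) ->
  (forall x, D x -> (f x <= g x)%E) ->
  (\int[mu]_(x in D) f x <= \int[mu]_(x in D) g x)%E.
Proof.
move=> f0 fg; apply: (@ge0_le_integral_ae D set0) => // x Dx.
- by apply: le_trans (f0 _ Dx) (fg _ Dx).
- by move=> _; exact: fg.
Qed.

End lower_integral.

(** * Simple functions, strong measurability and the integral of simple functions *)

Section simple.
Context d (T : measurableType d).

(** The codomain is a bare type, so that pairs of simple functions and indicators with boolean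
    values are simple functions too. *)
Definition is_simple (Z : Type) (f : T -> Z) : Prop :=
  finite_set (range f) /\ forall z, measurable (f @^-1` [set z]).

(** With a finite range, the preimage of any set is a finite union of measurable fibres. Hence
    simple functions can be composed with arbitrary maps, continuous or not. *)
Lemma is_simple_preimage (Z : Type) (f : T -> Z) (A : set Z) :
  is_simple f -> measurable (f @^-1` A).
Proof.
move=> [ff mf].
rewrite (_ : _ @^-1` _ = \bigcup_(z in range f `&` A) (f @^-1` [set z])).
  apply: fin_bigcup_measurable; [exact: finite_setIl | by move=> z _; exact: mf].
apply/seteqP; split => [t ft | t [z [_ Az] /= ->]] //=.
by exists (f t); split => //; exists t.
Qed.

Lemma is_simple_pair (Y Z : Type) (f : T -> Y) (g : T -> Z) :
  is_simple f -> is_simple g -> is_simple (fun t => (f t, g t)).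
Proof.
move=> [ff mf] [fg mg]; split.
  apply: (sub_finite_set (B := range f `*` range g)); last exact: finite_setX.
  by move=> _ [t _ <-]; split; exists t.
move=> [y z].
rewrite (_ : _ @^-1` _ = f @^-1` [set y] `&` g @^-1` [set z]).
  exact: measurableI.
by apply/seteqP; split => t /= [-> ->].
Qed.

Lemma is_simple_comp (Y Z : Type) (h : Y -> Z) (f : T -> Y) :
  is_simple f -> is_simple (h \o f).
Proof.
move=> sf; split; first by rewrite -(image_comp f h); apply: finite_image; case: sf.
by move=> z; rewrite comp_preimage; exact: is_simple_preimage.
Qed.

Lemma is_simple_comp2 (X Y Z : Type) (h : X -> Y -> Z) (f : T -> X) (g : T -> Y) :
  is_simple f -> is_simple g -> is_simple (fun t => h (f t) (g t)).
Proof.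
by move=> sf sg; apply: (is_simple_comp (fun z => h z.1 z.2) (is_simple_pair sf sg)).
Qed.

Lemma is_simple_cst (Z : Type) (z : Z) : is_simple (cst z : T -> Z).
Proof.
split; first exact: finite_image_cst.
move=> y; have [<-|zy] := pselect (z = y).
  by rewrite (_ : _ @^-1` _ = setT)//; apply/seteqP; split.
by rewrite (_ : _ @^-1` _ = set0)//; apply/seteqP; split.
Qed.

Lemma is_simple_mem (A : set T) : measurable A -> is_simple (fun t => t \in A).
Proof.
move=> mA; split; first exact: finite_finset.
case; last first.
  rewrite (_ : _ @^-1` _ = ~` A); first exact: measurableC.
  by apply/seteqP; split => t /=; [move=> tA /mem_set; rewrite tA|exact: memNset].
by rewrite (_ : _ @^-1` _ = A)//; apply/seteqP; split => t /=; [exact: set_mem|exact: mem_set].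
Qed.

Lemma is_simple_restrict (R : realType) (V : normedModType R) (A : set T) (f : T -> V) :
  measurable A -> is_simple f -> is_simple (fun t => if t \in A then f t else 0).
Proof.
move=> mA sf.
exact: (is_simple_comp2 (fun (b : bool) x => if b then x else 0)
  (is_simple_mem mA) sf).
Qed.

Lemma is_simple_fimfun (R : realType) (V : normedModType R) (s : {fimfun T >-> V}) :
  measurable_simple s <-> is_simple s.
Proof. by split=> [ms|[]//]; split. Qed.

Definition simple_fimfun (Z : Type) (f : T -> Z) (sf : is_simple f) : {fimfun T >-> Z} :=
  HB.pack f (FiniteImage.Build T Z f (proj1 sf)).

Lemma is_simple_measurable_norm (R : realType) (V : normedModType R) (f : T -> V)
  (D : set T) : is_simple f -> measurable_fun D (fun t => `|f t|).
Proof.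
move=> sf mD Y mY; apply: measurableI => //.
exact: (@is_simple_preimage _ f (fun v => Y `|v|)).
Qed.

Lemma simple_limit_measurable_norm (R : realType) (V : normedModType R)
    (D : set T) (s : nat -> T -> V) (f : T -> V) :
  (forall n, is_simple (s n)) -> (forall t, D t -> s n t @[n --> \oo] --> f t) ->
  measurable_fun D (fun t => `|f t|).
Proof.
move=> ss sf; apply: (@measurable_fun_cvg _ _ _ _ (fun n t => `|s n t|)).
  by move=> n; exact: is_simple_measurable_norm.
by move=> t Dt; apply: cvg_norm; exact: sf.
Qed.

Section strong.
Variables (R : realType) (mu : {measure set T -> \bar R}) (V : normedModType R).
Variable (D : set T).

(* A strongly measurable function need not be Borel; off a Borel null set [N]
   it is an everywhere limit of simple functions. *)
Lemma strongly_measurableP (f : T -> V) :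
  strongly_measurable mu D f <->
  exists N (s : nat -> T -> V), [/\ measurable N, mu N = 0%E,
    forall n, is_simple (s n) &
    forall t, D t -> ~ N t -> s n t @[n --> \oo] --> f t].
Proof.
split.
  move=> [s [ms [N [mN N0 DN]]]]; exists N, (fun n => s n : T -> V); split => //.
    by move=> n; exact/is_simple_fimfun.
  move=> t Dt Nt; apply: contrapT => nst; apply: Nt; apply: DN => /=.
  by move/(_ Dt).
move=> [N [s [mN N0 ss sf]]]; exists (fun n => simple_fimfun (ss n)); split.
  by move=> n y; exact: (proj2 (ss n)).
exists N; split => // t /= /not_implyP[Dt nst]; apply: contrapT => Nt.
by apply: nst; exact: sf.
Qed.

End strong.

Section simple_integral.
Variables (R : realType) (mu : {measure set T -> \bar R}) (V : normedModType R).
Variable (D : set T).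
Hypotheses (mD : measurable D) (muD : (mu D < +oo)%E).

Let m (A : set T) : R := fine (mu (D `&` A)).

(** Evaluates the integral of [s] on a finer partition, that of the fibres of [g]. Two simple
    functions can then be compared term by term on a common partition. *)
Lemma simple_integral_comp (Z : choiceType) (g : T -> Z) (phi : Z -> V)
    (s : {fimfun T >-> V}) :
  is_simple g -> (forall t, D t -> s t = phi (g t)) ->
  simple_integral mu D s =
  \sum_(z \in range g) fine (mu (D `&` g @^-1` [set z])) *: phi z.
Proof.
move=> sg sE; have [fg mg] := sg.
have mfin A : measurable A -> mu (D `&` A) \is a fin_num.
  move=> mA; rewrite ge0_fin_numE//; apply: le_lt_trans muD.
  by apply: le_measure; rewrite ?inE; [exact: measurableI|exact: mD|exact: subIsetl].
(* On [D] the level set of [y] is the disjoint union of the fibres of [g] over the [z] with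
   [phi z = y]. *)
have step y : m (s @^-1` [set y]) *: y =
    \sum_(z \in range g) if z \in phi @^-1` [set y] then m (g @^-1` [set z]) *: phi z else 0.
  rewrite -fsbig_mkcondr.
  have fin : finite_set (range g `&` phi @^-1` [set y]) by exact: finite_setIl.
  have -> : m (s @^-1` [set y]) =
      \sum_(z \in range g `&` phi @^-1` [set y]) m (g @^-1` [set z]).
    rewrite /m (_ : D `&` _ =
      \bigcup_(z in range g `&` phi @^-1` [set y]) (D `&` g @^-1` [set z])); last first.
      apply/seteqP; split => [t [Dt /= st]|t [z [_ /= zy] [Dt /= gt]]].
        exists (g t) => //; split; first by exists t.
        by rewrite /= -sE.
      by split => //=; rewrite sE// gt.
    rewrite measure_fin_bigcup//; last 2 first.
    - by move=> i j _ _ [t [[_ /= ->] [_ /= ->]]].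
    - by move=> i _; exact: measurableI.
    by rewrite !fsbig_finite//= sum_fine// => z _; exact: mfin.
  rewrite !fsbig_finite//= scaler_suml big_seq [RHS]big_seq.
  by apply: eq_bigr => z; rewrite in_fset_set// inE => -[_ /= ->].
rewrite /simple_integral; under eq_fsbigr do rewrite -[fine _]/(m _) step.
rewrite exchange_fsbig//; apply: eq_fsbigr => z /[!inE] -[t0 _ gt0].
(* A fibre of [g] that misses [D] has weight 0, and its [phi z] need not be a value of [s]. Any
   other [z] contributes to the single term [y = phi z]. *)
have [|gD] := eqVneq (D `&` g @^-1` [set z]) set0.
  move=> gD0; rewrite fsbig1; first by rewrite gD0 measure0 scale0r.
  by move=> y _; case: ifPn => // _; rewrite /m gD0 measure0 scale0r.
have [t [Dt gt]] : D `&` g @^-1` [set z] !=set0 by exact/set0P.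
have rz : range s (phi z) by exists t => //; rewrite sE// gt.
rewrite (fsbigD1 (phi z))// ?ifT ?inE//= fsbig1 ?addr0// => y [_ /= yz].
by rewrite ifF//; apply/negP; rewrite inE /= => /esym.
Qed.

(** Over the fibres of the pair [(s, s')] both sides are finite sums with the same weights, and the
    triangle inequality applies. This replaces linearity of the integral on simple functions. *)
Lemma simple_integral_dist (s s' : {fimfun T >-> V}) :
  measurable_simple s -> measurable_simple s' ->
  ((`|simple_integral mu D s - simple_integral mu D s'|)%:E <=
   \int[mu]_(t in D) (`|s t - s' t|)%:E)%E.
Proof.
move=> /is_simple_fimfun ss /is_simple_fimfun ss'.
pose g t := (s t, s' t).
have sg : is_simple g by exact: is_simple_pair.
have mfin A : measurable A -> mu (D `&` A) \is a fin_num.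
  move=> mA; rewrite ge0_fin_numE//; apply: le_lt_trans muD.
  by apply: le_measure; rewrite ?inE; [exact: measurableI|exact: mD|exact: subIsetl].
rewrite (@simple_integral_comp _ g fst)// (@simple_integral_comp _ g snd)//.
have fg := proj1 sg.
have -> : (\int[mu]_(t in D) (`|s t - s' t|)%:E =
    \int[mu]_(t in D) \sum_(z \in range g)
       (`|z.1 - z.2|%:E * (\1_(g @^-1` [set z]) t)%:E))%E.
  apply: eq_integral => t _.
  rewrite (fsbigD1 (g t))//=; last by exists t.
  rewrite indicE mem_set//= mule1 fsbig1 ?adde0// => z [_ /= zg].
  by rewrite indicE memNset ?mule0// => /= /esym.
rewrite ge0_integral_fsum//; last first.
  move=> z; apply: emeasurable_funM => //; apply/measurable_EFinP.
  by apply: measurable_indic; exact: (proj2 sg).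
have intE z : (\int[mu]_(t in D) (`|z.1 - z.2|%:E * (\1_(g @^-1` [set z]) t)%:E) =
    (`|z.1 - z.2| * fine (mu (D `&` g @^-1` [set z])))%:E)%E.
  rewrite (@ge0_integralZl_EFin _ _ _ mu D mD (fun t => (\1_(g @^-1` [set z]) t)%:E))//.
  - rewrite integral_indic//; last exact: (proj2 sg).
    by rewrite setIC -[in LHS](fineK (mfin _ (proj2 sg z))) -EFinM.
  - by apply/measurable_EFinP; apply: measurable_indic; exact: (proj2 sg).
rewrite (eq_fsbigr _ _ (fun z _ => intE z)).
rewrite !fsbig_finite//= -sumrB.
rewrite sumEFin lee_fin; apply: le_trans (ler_norm_sum _ _ _) _.
apply: ler_sum => z _; rewrite -scalerBr normrZ mulrC ler_wpM2l//.
by rewrite ger0_norm// fine_ge0.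
Qed.

End simple_integral.

End simple.

(** * The Bochner integral *)

Section bochner.
Context d (T : measurableType d) (R : realType).
Variables (mu : {measure set T -> \bar R}) (V : normedModType R).
Variable (D : set T).
Hypotheses (mD : measurable D) (muD : (mu D < +oo)%E).

(** Replacing [f] and its approximants by 0 on the null set [N] turns almost everywhere convergence
    into convergence on all of [D]. The norm of [g] is therefore Borel, and its lower integral is
    that of the norm of [f]. *)
Lemma strongly_measurable_regularize (f : T -> V) : strongly_measurable mu D f ->
  exists N (g : T -> V) (s : nat -> T -> V), [/\ measurable N, mu N = 0%E,
    forall n, is_simple (s n),
    forall t, D t -> s n t @[n --> \oo] --> g t &
    forall t, D t -> ~ N t -> g t = f t].
Proof.
move=> /strongly_measurableP[N [s [mN N0 ss sf]]].
exists N, (fun t => if t \in ~` N then f t else 0),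
  (fun n t => if t \in ~` N then s n t else 0); split => //.
- by move=> n; apply: is_simple_restrict => //; exact: measurableC.
- move=> t Dt; case: ifPn => [|_]; last exact: cvg_cst.
  by rewrite inE => Nt; exact: sf.
- by move=> t Dt Nt; rewrite ifT// inE.
Qed.

Lemma integrable_simpleP (s : {fimfun T >-> V}) :
  is_simple s -> integrable_simple mu D s.
Proof.
move=> ss; split; first exact/is_simple_fimfun.
move=> y _; apply: le_lt_trans muD; apply: le_measure; rewrite ?inE.
- by apply: measurableI => //; exact: (proj2 ss).
- exact: mD.
- exact: subIsetl.
Qed.

(* Contains the uniqueness of the integral ([f = f']) and the norm bound
   ([f' = 0]). *)
Lemma bochner_dist (f f' : T -> V) (I I' : V) :
  is_bochner_integral mu D f I -> is_bochner_integral mu D f' I' ->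
  ((`|I - I'|)%:E <= \int[mu]_(t in D) (`|f t - f' t|)%:E)%E.
Proof.
move=> [/strongly_measurable_regularize[N [g [sg [mN N0 ssg sgg gf]]]] [s [ss fs sI]]].
move=> [/strongly_measurable_regularize[N' [g' [sg' [mN' N'0 ssg' sgg' gf']]]] [s' [ss' fs' sI']]].
have mM : measurable (N `|` N') by exact: measurableU.
have M0 : mu (N `|` N') = 0%E by rewrite null_set_setU.
pose c := (\int[mu]_(t in D) (`|f t - f' t|)%:E)%E.
pose a n := (\int[mu]_(t in D) (`|f t - s n t|)%:E)%E.
pose a' n := (\int[mu]_(t in D) (`|f' t - s' n t|)%:E)%E.
have mnorm (h : T -> V) (sh : nat -> T -> V) : (forall n, is_simple (sh n)) ->
    (forall t, D t -> sh n t @[n --> \oo] --> h t) ->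
    measurable_fun D (fun t => (`|h t|)%:E).
  by move=> ssh shh; apply/measurable_EFinP; exact: (simple_limit_measurable_norm ssh shh).
(* The integrals of the approximants differ by at most the two approximation errors plus the
   integral to be reached; letting [n] tend to infinity removes the errors. *)
have key n : ((`|simple_integral mu D (s n) - simple_integral mu D (s' n)|)%:E
    <= a n + a' n + c)%E.
  apply: le_trans (simple_integral_dist mD muD (ss n).1 (ss' n).1) _.
  have isn : is_simple (s n) by apply/is_simple_fimfun; have [] := ss n.
  have isn' : is_simple (s' n) by apply/is_simple_fimfun; have [] := ss' n.
  have m1 : measurable_fun D (fun t => (`|g t - s n t|)%:E).
    apply: (mnorm _ (fun k t => sg k t - s n t)).
      by move=> k; exact: (is_simple_comp2 (fun x y => x - y) (ssg k) isn).
    by move=> t Dt; apply: cvgB; [exact: sgg|exact: cvg_cst].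
  have m2 : measurable_fun D (fun t => (`|g' t - s' n t|)%:E).
    apply: (mnorm _ (fun k t => sg' k t - s' n t)).
      by move=> k; exact: (is_simple_comp2 (fun x y => x - y) (ssg' k) isn').
    by move=> t Dt; apply: cvgB; [exact: sgg'|exact: cvg_cst].
  have m3 : measurable_fun D (fun t => (`|g t - g' t|)%:E).
    apply: (mnorm _ (fun k t => sg k t - sg' k t)).
      by move=> k; exact: (is_simple_comp2 (fun x y => x - y) (ssg k) (ssg' k)).
    by move=> t Dt; apply: cvgB; [exact: sgg|exact: sgg'].
  (* The triangle inequality goes through [g] and [g'], since additivity of the integral requires
     measurable functions; each term is then compared with the one for [f] and [f'] off a null
     set. *)
  apply: (@le_trans _ _ (\int[mu]_(t in D) (`|g t - s n t|%:E + `|g' t - s' n t|%:E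
      + `|g t - g' t|%:E))%E).
    apply: ge0_le_integral_nomeas => // t Dt.
    rewrite -!EFinD lee_fin.
    apply: le_trans (ler_distD (g t) _ _) _; rewrite (distrC (s n t)) -addrA lerD2l.
    by apply: le_trans (ler_distD (g' t) _ _) _; rewrite addrC.
  rewrite ge0_integralD//; last 2 first.
  - by move=> t Dt; rewrite adde_ge0.
  - exact: emeasurable_funD.
  rewrite ge0_integralD//.
  apply: leeD; [apply: leeD|].
  - apply: (ge0_le_integral_ae mN) => // t Dt Nt.
    by rewrite gf.
  - apply: (ge0_le_integral_ae mN') => // t Dt Nt.
    by rewrite gf'.
  - apply: (ge0_le_integral_ae mM) => // t Dt /not_orP[Nt Nt'].
    by rewrite gf// gf'.
apply: (@lee_cvg_to _ \oo _ _ _ (fun n => (a n + a' n + c)%E) _ _ _ _ (nearW _ key)).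
  by apply: cvg_EFin; [exact: nearW|apply: cvg_norm; exact: cvgB].
have c0 : (0 <= c)%E by exact: integral_ge0.
suff : (a n + a' n + c)%E @[n --> \oo] --> (0 + 0 + c)%E by rewrite !add0e.
apply: cvgeD; [by rewrite add0e|apply: cvgeD|exact: cvg_cst] => //.
Qed.

Lemma bochner_integralE (f : T -> V) (I : V) :
  is_bochner_integral mu D f I -> bochner_integral mu D f = I.
Proof.
move=> fI; apply: xget_subset1 => // J J' fJ fJ'.
have := bochner_dist fJ fJ'.
under eq_integral do rewrite subrr normr0.
by rewrite integral0 lee_fin normr_le0 subr_eq0 => /eqP.
Qed.

Lemma bochner_integralP (f : T -> V) : bochner_integrable mu D f ->
  is_bochner_integral mu D f (bochner_integral mu D f).
Proof. by move=> [I fI]; rewrite (bochner_integralE fI). Qed.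

Lemma bochner_norm_le (f : T -> V) (I : V) : is_bochner_integral mu D f I ->
  ((`|I|)%:E <= \int[mu]_(t in D) (`|f t|)%:E)%E.
Proof.
have s0 : is_simple (cst 0 : T -> V) by exact: is_simple_cst.
have I0 : is_bochner_integral mu D (cst 0 : T -> V) 0.
  split.
    apply/strongly_measurableP; exists set0, (fun=> cst 0); split => // t _ _.
    exact: cvg_cst.
  exists (fun=> simple_fimfun s0); split.
  - by move=> _; exact: (integrable_simpleP (s := simple_fimfun s0) s0).
  - rewrite (_ : (fun _ => _) = cst 0%E); first exact: cvg_cst.
    by apply/funext => n; under eq_integral do rewrite subrr normr0; exact: integral0.
  - rewrite (_ : (fun _ => _) = cst 0); first exact: cvg_cst.
    apply/funext => n; rewrite /simple_integral fsbig1// => y [t _ <-].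
    by rewrite scaler0.
move=> fI; have := bochner_dist fI I0; rewrite subr0.
by under eq_integral do rewrite subr0.
Qed.

End bochner.

(** * Existence of the Bochner integral in a complete space *)

Section bochner_existence.
Context d (T : measurableType d) (R : realType).
Variables (mu : {measure set T -> \bar R}) (V : completeNormedModType R).
Variable (D : set T).
Hypotheses (mD : measurable D) (muD : (mu D < +oo)%E).

(** Bochner's criterion. The approximants are cut off where their norm exceeds twice that of [g], so
    that their distance to [g] is dominated by [3 * |g|]. Dominated convergence makes the errors
    vanish, and the integrals of the approximants are then a Cauchy sequence. *)
Lemma bochner_integrableP (f : T -> V) : strongly_measurable mu D f ->
  (\int[mu]_(t in D) (`|f t|)%:E < +oo)%E -> bochner_integrable mu D f.
Proof.
move=> smf intf.
have [N [g [s [mN N0 ss sg gf]]]] := strongly_measurable_regularize smf.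
have mg : measurable_fun D (fun t => `|g t|) by exact: simple_limit_measurable_norm ss sg.
pose A n := D `&` [set t | `|s n t| <= 2 * `|g t|].
have mA n : measurable (A n).
  have : measurable_fun D (fun t => `|s n t| <= 2 * `|g t|).
    apply: measurable_fun_ler; first exact: is_simple_measurable_norm.
    exact: measurable_funM.
  by move=> /(_ mD [set true] I).
pose s' n t := if t \in A n then s n t else 0.
have ss' n : is_simple (s' n) by exact: is_simple_restrict.
(* Where [g] vanishes the truncated functions are 0. Elsewhere the norms converge to a limit smaller
   than [2 * |g t|], and the cut-off is eventually inactive. *)
have s'g t : D t -> s' n t @[n --> \oo] --> g t.
  move=> Dt; have [g0|gN0] := eqVneq (g t) 0.
    rewrite g0; have -> : (fun n => s' n t) = cst 0; last exact: cvg_cst.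
    apply/funext => n; rewrite /s'; case: ifPn => //; rewrite inE => -[_ /=].
    by rewrite g0 normr0 mulr0 normr_le0 => /eqP.
  apply: cvg_trans (sg _ Dt); apply: near_eq_cvg.
  have gpos : 0 < `|g t| by rewrite normr_gt0.
  have [|n _ H] := cvgr_norm_le _ (sg _ Dt) (2 * `|g t|); first by lra.
   exists n => // m nm /=.
  by rewrite /s' ifT// inE; split => //=; exact: H.
pose e n := (\int[mu]_(t in D) (`|g t - s' n t|)%:E)%E.
have e0 : e n @[n --> \oo] --> 0%E.
  have ig : mu.-integrable D (fun t => (3 * `|g t|)%:E).
    apply/integrableP; split.
      by apply/measurable_EFinP; exact: measurable_funM.
    apply: (@le_lt_trans _ _ (3%:E * \int[mu]_(t in D) (`|f t|)%:E)%E); last first.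
      by rewrite lte_mul_pinfty// lee_fin.
    apply: (@le_trans _ _ (3%:E * \int[mu]_(t in D) (`|g t|)%:E)%E).
      rewrite -(@ge0_integralZl_EFin _ _ _ mu D mD (fun t => (`|g t|)%:E))//.
        by apply: ge0_le_integral_nomeas => // t Dt; rewrite /= ger0_norm// mulr_ge0.
      exact/measurable_EFinP.
    apply: lee_wpmul2l; first by rewrite lee_fin.
    by apply: (ge0_le_integral_ae mN) => // t Dt Nt; rewrite gf.
  have := @dominated_convergence _ _ _ mu D mD
    (fun n t => (`|g t - s' n t|)%:E) (cst 0%E) (fun t => (3 * `|g t|)%:E).
  case => //.
  - move=> n; apply/measurable_EFinP.
    apply: (@simple_limit_measurable_norm _ _ _ _ _ (fun k t => s k t - s' n t)).
      by move=> k; exact: (is_simple_comp2 (fun x y => x - y) (ss k) (ss' n)).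
    by move=> t Dt; apply: cvgB; [exact: sg|exact: cvg_cst].
  - apply: aeW => t Dt; apply: cvg_EFin; first exact: nearW.
    rewrite -(normr0 V) -(subrr (g t)).
    by apply: cvg_norm; apply: cvgB; [exact: cvg_cst|exact: s'g].
  - apply: aeW => t n Dt; rewrite /= lee_fin normr_id.
    apply: le_trans (ler_normB _ _) _.
    rewrite /s'; case: ifPn => [|_]; last by rewrite normr0; have := normr_ge0 (g t); lra.
    by rewrite inE => -[_ /=]; lra.
  by move=> _ _; rewrite integral0.
have ef n : (\int[mu]_(t in D) (`|f t - s' n t|)%:E <= e n)%E.
  by apply: (ge0_le_integral_ae mN) => // t Dt Nt; rewrite gf.
pose S n := simple_integral mu D (simple_fimfun (ss' n)).
have e_small (r : R) : 0 < r -> \forall n \near \oo, (e n < r%:E)%E.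
  move=> r0; have : nbhs (0 : \bar R)%E [set x | (x < r%:E)%E].
    by apply: open_ereal_lt'; rewrite lte_fin.
  by move=> /e0.
have Sdist n m : ((`|S n - S m|)%:E <= e n + e m)%E.
  apply: le_trans (@simple_integral_dist _ _ _ mu _ D mD muD (simple_fimfun (ss' n))
    (simple_fimfun (ss' m)) (proj2 (ss' n)) (proj2 (ss' m))) _.
  have mk k : measurable_fun D (fun t => (`|g t - s' k t|)%:E).
    apply/measurable_EFinP.
    apply: (@simple_limit_measurable_norm _ _ _ _ _ (fun j t => s j t - s' k t)).
      by move=> j; exact: (is_simple_comp2 (fun x y => x - y) (ss j) (ss' k)).
    by move=> t Dt; apply: cvgB; [exact: sg|exact: cvg_cst].
  rewrite -ge0_integralD//; apply: ge0_le_integral_nomeas => // t Dt.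
  by rewrite -EFinD lee_fin (distrC (g t)) ler_distD.
have /cvg_ex[I SI] : cvgn S.
  suff : cauchy (S @ \oo) by exact: cauchy_cvg.
  suff : cauchy_ex (S @ \oo) by exact: cauchy_exP.
  move=> r r0.
  have [n _ en] := e_small (r / 2) (divr_gt0 r0 (ltr0Sn R 1)).
  exists (S n); exists n => // m nm /=.
  rewrite -ball_normE /= -lte_fin; apply: le_lt_trans (Sdist _ _) _.
  by rewrite [r]splitr EFinD lteD// en/=.
exists I; split => //; exists (fun n => simple_fimfun (ss' n)); split => //.
  by move=> n; exact: (integrable_simpleP mD muD (s := simple_fimfun (ss' n)) (ss' n)).
apply: (@squeeze_cvge _ \oo _ _ (cst 0%E) _ e) => //; last exact: cvg_cst.
by apply: nearW => n; rewrite integral_ge0//=; exact: ef.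
Qed.

End bochner_existence.

(** * Extension of the integrand by zero *)

Section bochner_extension.
Context d (T : measurableType d) (R : realType).
Variables (mu : {measure set T -> \bar R}) (V : normedModType R).
Variables (D D' : set T).
Hypotheses (mD : measurable D) (muD : (mu D < +oo)%E).
Hypotheses (mD' : measurable D') (DD' : D' `<=` D).

(** Brings convolutions at different times, which are integrals over different intervals, to one
    interval where [bochner_dist] can compare them. *)
Lemma bochner_extension (f : T -> V) (I : V) :
  is_bochner_integral mu D' f I ->
  is_bochner_integral mu D (fun t => if t \in D' then f t else 0) I.
Proof.
have muD' : (mu D' < +oo)%E by apply: le_lt_trans muD; apply: le_measure; rewrite ?inE.
move=> [/strongly_measurableP[N [s [mN N0 ss sf]]] [h [sh fh hI]]]; split.
  apply/strongly_measurableP; exists N, (fun n t => if t \in D' then s n t else 0).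
  split => //; first by move=> n; exact: is_simple_restrict.
  move=> t Dt Nt; case: ifPn => [|_]; last exact: cvg_cst.
  by rewrite inE => D't; exact: sf.
have ish n : is_simple (h n) by apply/is_simple_fimfun; have [] := sh n.
have ish' n : is_simple (fun t => if t \in D' then h n t else 0) by exact: is_simple_restrict.
exists (fun n => simple_fimfun (ish' n)); split.
- by move=> n; exact: (integrable_simpleP mD muD (s := simple_fimfun (ish' n)) (ish' n)).
- rewrite (_ : (fun n => _) = (fun n => \int[mu]_(t in D') (`|f t - h n t|)%:E)%E)//.
  apply/funext => n; rewrite integral_mkcond [RHS]integral_mkcond.
  apply: eq_integral => t _; rewrite !patchE /=.
  have [D't|D't] := boolP (t \in D'); last by rewrite subrr normr0; case: ifP.
  by rewrite (mem_set (DD' (set_mem D't))).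
- rewrite (_ : (fun n => _) = (fun n => simple_integral mu D' (h n)))//.
  (* Both integrals are summed over the range of the same [g]. When the boolean is false, the value
     over [D] is 0 and the fibre misses [D']. *)
  apply/funext => n; pose g t := (h n t, t \in D').
  have sg : is_simple g by apply: is_simple_pair => //; exact: is_simple_mem.
  rewrite (@simple_integral_comp _ _ _ _ _ _ mD muD _ g (fun z => if z.2 then z.1 else 0))//.
  rewrite (@simple_integral_comp _ _ _ _ _ _ mD' muD' _ g fst)//.
  apply: eq_fsbigr => -[y b] _ /=; case: b => /=.
    congr (fine (mu _) *: _); apply/seteqP; split => t [Dt [hy tD']]; split => /=;
      rewrite /g ?hy ?tD'//; [exact: set_mem|exact: DD'].
  rewrite scaler0 (_ : _ `&` _ = set0) ?measure0 ?scale0r//.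
  by apply/seteqP; split => // t [/mem_set D't [_]]; rewrite D't.
Qed.

End bochner_extension.

(** * Strongly continuous semigroups and convolutions *)

Section sequential_continuity.
Context (R : realType) (V : normedModType R).

(** Dominated convergence and the approximation by simple functions both work with sequences. For
    the converse, a failure of continuity at [t] provides points of [A] within [1/(n+1)] of [t]
    whose images stay at distance at least [e]. *)
Lemma within_continuous_seqP (A : set R) (f : R -> V) :
  {within A, continuous f} <->
  forall (u : nat -> R) t, (forall n, A (u n)) -> A t -> u n @[n --> \oo] --> t ->
    f (u n) @[n --> \oo] --> f t.
Proof.
split.
  move=> /subspace_continuousP cf u t uA At ut P /= Pf.
  have /ut := cf t At P Pf.
  by move=> [n _ H]; exists n => // m /H; exact.
move=> cf; apply/subspace_continuousP => t At; apply/cvgrPdist_lt => e e0.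
apply: contrapT => nf.
have /choice[u Hu] : forall n, exists z, [/\ A z, `|t - z| < n.+1%:R^-1 & e <= `|f t - f z|].
  move=> n; apply: contrapT => /forallNP Hn; apply: nf.
  exists n.+1%:R^-1 => /=; first by rewrite invr_gt0.
  move=> z /= tz Az; rewrite ltNge; apply/negP => ez.
  exact: (Hn z).
have ut : u n @[n --> \oo] --> t.
  apply/cvgrPdist_lt => r r0; near=> n.
  have [_ h _] := Hu n; apply: lt_trans h _.
  by near: n; exact: near_infty_natSinv_lt (PosNum r0).
have uA n : A (u n) by have [] := Hu n.
have /cvgrPdist_lt /(_ _ e0)[n _ /(_ n (leqnn n)) /=] := cf u t uA At ut.
by have [_ _] := Hu n; rewrite ltNge => ->.
Unshelve. all: by end_near. Qed.

End sequential_continuity.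

Section bounded_linear.
Context (R : realType) (V W : normedModType R).

Lemma linear_subr (f : V -> W) (x y : V) : linear f -> f (x - y) = f x - f y.
Proof. by move=> lf; have := lf (-1) y x; rewrite !scaleN1r ![- _ + _]addrC. Qed.

Lemma linear_unit_ball_bound (f : V -> W) (M : R) : linear f ->
  (forall x, `|x| <= 1 -> `|f x| <= M) -> forall x, `|f x| <= M * `|x|.
Proof.
move=> lf fM x.
have fZ a y : f (a *: y) = a *: f y.
  have f0 : f 0 = 0 by have := lf (-1) 0 0; rewrite scaler0 add0r scaleN1r addNr.
  by have := lf a y 0; rewrite f0 !addr0.
have [->|x0] := eqVneq x 0.
  by have := fZ 0 0; rewrite !scale0r => ->; rewrite !normr0 mulr0.
have nx : 0 < `|x| by rewrite normr_gt0.
have := fM (`|x|^-1 *: x); rewrite fZ !normrZ normfV normr_id mulVf ?gt_eqF//.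
by move=> /(_ (lexx _)); rewrite ler_pdivrMl// mulrC.
Qed.

Lemma le_opnorm (f : V -> W) : bounded_linear f -> forall x, `|f x| <= opnorm f * `|x|.
Proof.
move=> [lf bf]; apply: linear_unit_ball_bound => // x x1.
have [M fM] := bf 1; apply: ub_le_sup; last by exists x.
by exists M => _ [y y1 <-]; exact: fM.
Qed.

End bounded_linear.

Section semigroup.
Context (R : realType) (X : completeNormedModType R) (T : R -> X -> X).
Hypothesis semigroup_T : C0_semigroup T.

Lemma C0_semigroup_cvg0 (x : X) (e : R) : 0 < e ->
  exists d : R, 0 < d /\ forall h, 0 <= h < d -> `|T h x - x| < e.
Proof.
have [_ T0 _ cT] := semigroup_T => e0.
have /cvgrPdist_lt /(_ _ e0) [d /= d0 H] := cT x.
exists d; split => // h /andP[]; rewrite le_eqVlt => /predU1P[<- _|h0 hd].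
  by rewrite T0 /= subrr normr0.
by rewrite distrC; apply: H => //=; rewrite sub0r normrN gtr0_norm.
Qed.

(** Otherwise there are times [t n] tending to 0 at which the bound [n + 1] fails. Yet [T (t n) x]
    converges to [x], hence is bounded for each [x], and Banach-Steinhaus gives a uniform bound. *)
Lemma C0_semigroup_locally_bounded : exists d M : R, [/\ 0 < d, 1 <= M &
  forall t x, 0 <= t <= d -> `|T t x| <= M * `|x|].
Proof.
have [bT T0 _ cT] := semigroup_T.
apply: contrapT => nb.
have /choice[t Ht] : forall n : nat, exists t, (0 <= t <= n.+1%:R^-1) /\
    exists x, n.+1%:R * `|x| < `|T t x|.
  move=> n; apply: contrapT => /forallNP Hn; apply: nb.
  exists n.+1%:R^-1, n.+1%:R; split => //; first by rewrite ler1n.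
  move=> t x tn; rewrite leNgt; apply/negP => h.
  by apply: (Hn t); split => //; exists x.
have t_gt0 n : 0 < t n.
  have [/andP[t0 _] [x h]] := Ht n; rewrite lt_neqAle t0 andbT; apply/eqP => tn0.
  by move: h; rewrite -tn0 T0 /= ltNge ler_peMl// ler1n.
have t0 : t n @[n --> \oo] --> 0.
  apply/cvgrPdist_lt => r r0; near=> n.
  have [/andP[_ h] _] := Ht n; rewrite sub0r normrN gtr0_norm//; apply: le_lt_trans h _.
  by near: n; exact: near_infty_natSinv_lt (PosNum r0).
have ub : uniform_bounded (range (fun n => T (t n))).
  apply: Banach_Steinhauss.
    by move=> _ [n _ <-]; have [] := bT (t n) (ltW (t_gt0 n)).
  move=> x; have Tx : T (t n) x @[n --> \oo] --> x.
    apply/cvgrPdist_lt => e e0; have [d [d0 Hd]] := C0_semigroup_cvg0 x e0.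
    have /cvgrPdist_lt /(_ _ d0) [n _ H] := t0; exists n => // m /H /=.
    rewrite sub0r normrN gtr0_norm// => tmd.
    by rewrite distrC; apply: Hd; rewrite tmd ltW.
  have : bounded_fun (fun n => T (t n) x) by apply: cvg_seq_bounded; apply/cvg_ex; exists x.
  move=> [M [_ /(_ (M + 1))]]; rewrite ltrDl ltr01 => /(_ isT) HM.
  by exists (M + 1) => _ [n _ <-]; exact: HM.
have [M HM] := ub 1.
(* At the index [truncn M] the violated bound is [truncn M + 1], which exceeds the uniform bound
   [M]. *)
have [_ [x]] := Ht (Num.truncn M); apply/negP; rewrite -leNgt.
have [lT _] := bT (t (Num.truncn M)) (ltW (t_gt0 _)).
apply: le_trans (_ : M * `|x| <= _); last first.
  by rewrite ler_wpM2r// ltW// truncnS_gt.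
by apply: linear_unit_ball_bound => // y; apply: HM; exists (Num.truncn M).
Unshelve. all: by end_near. Qed.

End semigroup.

Section interval_approximation.
Context (R : realType).
Import HBNNSimple.

(** The approximants of the identity increase, so [q n s] stays in [[0, s]]. Thus [t - q n s]
    remains a time at which the semigroup is defined and bounded. *)
Lemma interval_simple_approx (t : R) : exists q : nat -> R -> R,
  (forall n, is_simple (q n)) /\
  forall s, 0 <= s <= t -> (forall n, 0 <= q n s <= s) /\ q n s @[n --> \oo] --> s.
Proof.
have mf : measurable_fun (`[0, t]%classic : set R) (@EFin R) by exact/measurable_EFinP.
have mD : measurable (`[0, t]%classic : set R) by [].
pose q n := nnsfun_approx mD mf n.
exists (fun n => q n : R -> R); split => [n|s s0t]; first by split.
have Ds : `[0, t]%classic s by rewrite /= in_itv.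
have qs : q n s @[n --> \oo] --> s.
  have p0 (x : R) : `[0, t]%classic x -> (0 <= x%:E)%E.
    by rewrite /= in_itv /= lee_fin => /andP[].
  by have /fine_cvgP[] := @cvg_nnsfun_approx _ _ _ _ mD _ mf p0 s Ds.
split => // n; apply/andP; split; first exact: fun_ge0.
rewrite -[leRHS](cvg_lim _ qs)//; apply: nondecreasing_cvgn_le; last by apply/cvg_ex; exists s.
by move=> a b ab; exact/lefP/nd_nnsfun_approx.
Qed.

End interval_approximation.

Definition convolution (R : realType) (X : normedModType R) (T : R -> X -> X)
    (v : R -> X) (t : R) : X :=
  bochner_integral lebesgue_measure `[0, t] (fun s => T (t - s) (v s)).

Section convolution.
Context (R : realType) (X : completeNormedModType R) (T : R -> X -> X).
Hypothesis semigroup_T : C0_semigroup T.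
Variables (d M : R).
Hypotheses (M_ge0 : 0 <= M)
  (T_bound : forall t x, 0 <= t <= d -> `|T t x| <= M * `|x|).

Local Notation mu := (@lebesgue_measure R).

Lemma semigroupB t x y : 0 <= t -> T t (x - y) = T t x - T t y.
Proof.
move=> t0; have [bT _ _ _] := semigroup_T; have [lT _] := bT t t0.
exact: linear_subr.
Qed.

(** For [b <= a], [T a x - T b x] is [T b] applied to [T (a - b) x - x]. Right continuity at 0 thus
    gives continuity from both sides at every time. *)
Lemma semigroup_dist a b x : 0 <= a <= d -> 0 <= b <= d ->
  `|T a x - T b x| <= M * `|T `|a - b| x - x|.
Proof.
wlog ba : a b / b <= a => [hw a0d b0d|].
  have [|/ltW] := leP b a; first by move=> ?; exact: hw.
  by move=> ab; rewrite distrC (distrC a); exact: hw.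
move=> /andP[a0 ad] /andP[b0 bd]; have [_ _ TD _] := semigroup_T.
have ab0 : 0 <= a - b by rewrite subr_ge0.
have -> : T a x = T b (T (a - b) x) by rewrite -[RHS]/((T b \o _) x) -TD// subrKC.
rewrite (ger0_norm ab0) -semigroupB//.
by apply: T_bound; rewrite b0.
Qed.

(** Joint continuity in time and state: the time variation is measured at the fixed [x], and the
    uniform bound [M] absorbs the variation of the state. *)
Lemma semigroup_cvg (u : nat -> R) (v : nat -> X) t x :
  (forall n, 0 <= u n <= d) -> 0 <= t <= d -> u n @[n --> \oo] --> t ->
  v n @[n --> \oo] --> x -> T (u n) (v n) @[n --> \oo] --> T t x.
Proof.
move=> ud td ut vx; apply/cvgrPdist_lt => e e0.
(* [M] may be 0, hence the division by [M + 1]. *)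
have M1 : 0 < M + 1 by have := M_ge0; lra.
have e' : 0 < e / (M + 1) / 2 by rewrite !divr_gt0.
have [r [r0 Hr]] := C0_semigroup_cvg0 semigroup_T x e'.
near=> n.
have un : `|t - u n| < r by near: n; exact: cvgr_dist_lt.
have vn : `|x - v n| < e / (M + 1) / 2 by near: n; exact: cvgr_dist_lt.
apply: le_lt_trans (ler_distD (T (u n) x) _ _) _.
have -> : T (u n) x - T (u n) (v n) = T (u n) (x - v n).
  by rewrite semigroupB//; case/andP: (ud n).
apply: (@le_lt_trans _ _ (M * (e / (M + 1) / 2) + M * (e / (M + 1) / 2))).
  apply: lerD.
    apply: le_trans (semigroup_dist _ _ _) _ => //.
    by apply: ler_wpM2l => //; apply/ltW/Hr; rewrite normr_ge0.
  apply: le_trans (T_bound _ (ud n)) _.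
  by apply: ler_wpM2l => //; exact: ltW.
have -> : M * (e / (M + 1) / 2) + M * (e / (M + 1) / 2) = M / (M + 1) * e by field; rewrite gt_eqF.
by rewrite gtr_pMl// ltr_pdivrMr// mul1r ltrDl.
Unshelve. all: by end_near. Qed.

Lemma itv_mem (a t s : R) : (s \in `[a, t]%classic) = (a <= s <= t).
Proof. by rewrite mem_setE in_itv. Qed.

Lemma itv_finite (a t : R) : (mu `[a, t] < +oo)%E.
Proof.
have := lebesgue_measure_itv `[a, t] => /= ->.
by case: ifP => _; rewrite ?ltry// -EFinB ltry.
Qed.

(** Freezing both the time, by [q n], and the state, by [s n], gives a function of a pair of simple
    functions, hence a simple one; joint continuity of the semigroup gives the limit. *)
Lemma convolution_simple_approx (t : R) (N : set R) (v : R -> X) (s : nat -> R -> X) :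
  0 <= t <= d -> (forall n, is_simple (s n)) ->
  (forall r, 0 <= r <= t -> ~ N r -> s n r @[n --> \oo] --> v r) ->
  exists k : nat -> R -> X, (forall n, is_simple (k n)) /\
    forall r, 0 <= r <= t -> ~ N r -> k n r @[n --> \oo] --> T (t - r) (v r).
Proof.
move=> /andP[t0 td] ss sv; have [q [sq qc]] := interval_simple_approx t.
exists (fun n r => T (t - q n r) (s n r)); split.
  by move=> n; exact: (is_simple_comp2 (fun a x => T (t - a) x) (sq n) (ss n)).
move=> r rt Nr; have [qr qcr] := qc _ rt; have /andP[r0 rlet] := rt.
apply: semigroup_cvg.
- move=> n; have /andP[? ?] := qr n; apply/andP; split; lra.
- by apply/andP; split; lra.
- by apply: cvgB => //; exact: cvg_cst.
- exact: sv.
Qed.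

Lemma convolution_strongly_measurable (t : R) (v : R -> X) : 0 <= t <= d ->
  strongly_measurable mu `[0, t] v ->
  strongly_measurable mu `[0, t] (fun s => T (t - s) (v s)).
Proof.
move=> t0 /strongly_measurableP[N [s [mN N0 ss sv]]].
have [|k [sk kv]] := convolution_simple_approx (N := N) (v := v) t0 ss.
  by move=> r rt; apply: sv; rewrite /= in_itv.
apply/strongly_measurableP; exists N, k; split => // r; rewrite /= in_itv; exact: kv.
Qed.

Lemma strongly_measurable_subset (A A' : set R) (v : R -> X) : A' `<=` A ->
  strongly_measurable mu A v -> strongly_measurable mu A' v.
Proof.
move=> AA' /strongly_measurableP[N [s [mN N0 ss sv]]].
by apply/strongly_measurableP; exists N, s; split => // t /AA'; exact: sv.
Qed.

(* Dominated by a multiple of a regularized version of [|v|], since the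
   lower integral is homogeneous only on measurable functions. *)
Lemma strongly_measurable_integralZ (V W : normedModType R) (A : set R)
    (v : R -> V) (w : R -> W) (c : R) : measurable A -> 0 <= c ->
  strongly_measurable mu A v -> (forall t, A t -> `|w t| <= c * `|v t|) ->
  (\int[mu]_(t in A) (`|w t|)%:E <= c%:E * \int[mu]_(t in A) (`|v t|)%:E)%E.
Proof.
move=> mA c0 /strongly_measurable_regularize[N [g [s [mN N0 ss sg gv]]]] wv.
apply: (@le_trans _ _ (\int[mu]_(t in A) (c * `|g t|)%:E)%E).
  apply: (ge0_le_integral_ae mN) => // t At; first by rewrite lee_fin mulr_ge0.
  by move=> Nt; rewrite lee_fin gv//; exact: wv.
under eq_integral do rewrite EFinM.
rewrite (@ge0_integralZl_EFin _ _ _ mu A mA (fun t => (`|g t|)%:E))//.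
  apply: lee_wpmul2l; first by rewrite lee_fin.
  by apply: (ge0_le_integral_ae mN) => // t At Nt; rewrite gv.
by apply/measurable_EFinP; exact: (simple_limit_measurable_norm ss sg).
Qed.

Lemma subset_integral_nomeas (A A' : set R) (f : R -> \bar R) : A' `<=` A ->
  (forall t, A t -> (0 <= f t)%E) ->
  (\int[mu]_(t in A') f t <= \int[mu]_(t in A) f t)%E.
Proof.
move=> AA' f0; rewrite integral_mkcond [leRHS]integral_mkcond.
apply: ge0_le_integral_nomeas => t _; rewrite !patchE.
  by case: ifPn => //; rewrite inE => /AA'; exact: f0.
case: ifPn => [At|_]; first by rewrite ifT// inE; apply: AA'; rewrite inE in At.
by case: ifPn => //; rewrite inE => /f0.
Qed.

Section integrable_input.
Variables (tau : R) (v : R -> X).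
Hypotheses (tau_le : tau <= d)
  (mv : strongly_measurable mu `[0, tau] v)
  (iv : (\int[mu]_(t in `[0%R, tau]) (`|v t|)%:E < +oo)%E).

Let subtau t : t <= tau -> `[0, t]%classic `<=` `[0, tau]%classic.
Proof. by move=> tt s /=; rewrite !in_itv /= => /andP[-> /le_trans]; apply. Qed.

Lemma convolution_integral_le t : 0 <= t <= tau ->
  (\int[mu]_(s in `[0%R, t]) (`|T (t - s)%R (v s)|)%:E <=
   M%:E * \int[mu]_(s in `[0%R, tau]) (`|v s|)%:E)%E.
Proof.
move=> /andP[t0 tt]; apply: le_trans (_ : M%:E * \int[mu]_(s in `[0%R, t]) (`|v s|)%:E <= _)%E.
  apply: strongly_measurable_integralZ => //.
    exact: (strongly_measurable_subset (subtau tt) mv).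
  move=> s; rewrite /= in_itv /= => /andP[s0 st]; apply: T_bound.
  by have td := tau_le; apply/andP; split; lra.
by apply: lee_wpmul2l; [rewrite lee_fin|apply: subset_integral_nomeas => //; exact: subtau].
Qed.

Lemma convolution_integrable t : 0 <= t <= tau ->
  bochner_integrable mu `[0, t] (fun s => T (t - s) (v s)).
Proof.
move=> tt; have /andP[t0 ttau] := tt; apply: bochner_integrableP => //.
- exact: itv_finite.
- apply: convolution_strongly_measurable; first by rewrite t0 (le_trans ttau).
  exact: (strongly_measurable_subset (subtau ttau) mv).
- apply: le_lt_trans (convolution_integral_le tt) _.
  by rewrite lte_mul_pinfty// lee_fin.
Qed.

Lemma convolution_norm_le t : 0 <= t <= tau ->
  ((`|convolution T v t|)%:E <= M%:E * \int[mu]_(s in `[0%R, tau]) (`|v s|)%:E)%E.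
Proof.
move=> tt; apply: le_trans (convolution_integral_le tt).
have muD := itv_finite 0 t.
exact: (bochner_norm_le _ muD (bochner_integralP _ muD (convolution_integrable tt))).
Qed.

(** Both convolutions are integrals over [[0, tau]] of kernels [k] extended by zero. The kernels
    converge at every [r] other than [t] and are bounded by [M * |g|], so dominated convergence
    applies. *)
Lemma convolution_cvg (u : nat -> R) (t : R) :
  (forall n, 0 <= u n <= tau) -> 0 <= t <= tau -> u n @[n --> \oo] --> t ->
  convolution T v (u n) @[n --> \oo] --> convolution T v t.
Proof.
move=> utau ttau ut.
have [N [g [s [mN N0 ss sg gv]]]] := strongly_measurable_regularize mv.
pose k t r := if r \in `[0, t]%classic then T (t - r) (g r) else 0.
have led a : 0 <= a <= tau -> 0 <= a <= d by move=> /andP[-> /le_trans]; apply.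
have kapprox a : 0 <= a <= tau -> exists q : nat -> R -> X,
    (forall n, is_simple (q n)) /\ forall r, q n r @[n --> \oo] --> k a r.
  move=> atau; have [|q [sq qk]] := convolution_simple_approx (N := set0) (v := g) (led _ atau) ss.
    move=> r /andP[r0 ra] _; apply: sg; rewrite /= in_itv /= r0.
    by case/andP: atau => _; exact: le_trans.
  exists (fun n r => if r \in `[0, a]%classic then q n r else 0); split.
    by move=> n; apply: is_simple_restrict.
  move=> r; rewrite /k; case: ifPn => [|_]; last exact: cvg_cst.
  by rewrite itv_mem => ra; exact: qk.
have mk a b : 0 <= a <= tau -> 0 <= b <= tau ->
    measurable_fun `[0, tau]%classic (fun r => `|k a r - k b r|).
  move=> /kapprox[q [sq qk]] /kapprox[q' [sq' qk']].
  apply: (@simple_limit_measurable_norm _ _ _ _ _ (fun n r => q n r - q' n r)).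
    by move=> n; exact: (is_simple_comp2 (fun x y => x - y) (sq n) (sq' n)).
  by move=> r _; exact: cvgB.
pose E n := (\int[mu]_(r in `[0%R, tau]) (`|k (u n) r - k t r|)%:E)%E.
have kbound a r : 0 <= a <= tau -> `|k a r| <= M * `|g r|.
  move=> atau; rewrite /k; case: ifPn => [|_]; last by rewrite normr0 mulr_ge0.
  rewrite itv_mem => /andP[r0 ra]; apply: T_bound.
  by have /andP[? ?] := led _ atau; apply/andP; split; lra.
have mg : measurable_fun `[0, tau]%classic (fun r => `|g r|).
  exact: (simple_limit_measurable_norm ss sg).
have E0 : E n @[n --> \oo] --> 0%E.
  have ig : (mu : {measure set _ -> \bar R}).-integrable `[0, tau]%classic
      (fun r => (M * `|g r| + M * `|g r|)%:E).
    apply/integrableP; split.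
      by apply/measurable_EFinP; apply: measurable_funD; exact: measurable_funM.
    apply: (@le_lt_trans _ _ ((M + M)%:E * \int[mu]_(r in `[0%R, tau]) (`|v r|)%:E)%E); last first.
      by rewrite lte_mul_pinfty// lee_fin addr_ge0.
    apply: (@le_trans _ _ ((M + M)%:E * \int[mu]_(r in `[0%R, tau]) (`|g r|)%:E)%E).
      rewrite -(@ge0_integralZl_EFin _ _ _ mu _ _ (fun r => (`|g r|)%:E))//.
      - apply: ge0_le_integral_nomeas => // r _.
        by rewrite /= ger0_norm ?addr_ge0 ?mulr_ge0// -EFinM mulrDl.
      - exact/measurable_EFinP.
      - exact: addr_ge0.
    apply: lee_wpmul2l; first by rewrite lee_fin addr_ge0.
    by apply: (ge0_le_integral_ae mN) => // r Dr Nr; rewrite gv.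
  have := @dominated_convergence _ _ _ mu `[0, tau]%classic _
    (fun n r => (`|k (u n) r - k t r|)%:E) (cst 0%E) (fun r => (M * `|g r| + M * `|g r|)%:E).
  case => //.
  - by move=> n; apply/measurable_EFinP; exact: mk.
  (* Only at [r = t] may the indicator of [[0, u n]] fail to converge. *)
  - exists [set t]; split => //; first exact: lebesgue_measure_set1.
    move=> r /= nkr; apply: contrapT => rt; apply: nkr => Dr.
    apply: cvg_EFin; first exact: nearW.
    rewrite -(normr0 X) -(subrr (k t r)); apply: cvg_norm; apply: cvgB; last exact: cvg_cst.
    move: Dr; rewrite /= in_itv /= => /andP[r0 rtau].
    have [rltt|] := ltP r t; last first.
      rewrite le_eqVlt => /predU1P[tr|tltr]; first by case: rt.
      have -> : k t r = 0 by rewrite /k itv_mem r0 /= leNgt tltr.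
      have [n _ un] := cvgr_lt _ ut _ tltr.
      apply: cvg_near_cst; exists n => // m /un /= umr.
      by rewrite /k itv_mem r0 /= leNgt umr.
    have -> : k t r = T (t - r) (g r) by rewrite /k itv_mem r0 ltW.
    have [n0 _ un] := cvgr_gt _ ut _ rltt.
    (* For finitely many [n] the time [u n - r] may be negative; there it is replaced by [t - r], so
       that all terms lie in [[0, d]]. *)
    pose w n := if r <= u n then u n - r else t - r.
    have wt : w n @[n --> \oo] --> t - r.
      apply: cvg_trans (cvgB ut (cvg_cst r)); apply: near_eq_cvg.
      by exists n0 => // m /un /= /ltW rum; rewrite /w rum.
    have Tw : T (w n) (g r) @[n --> \oo] --> T (t - r) (g r).
      have /andP[? ?] := led _ ttau.
      apply: semigroup_cvg => //; last exact: cvg_cst.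
        move=> n; have /andP[? ?] := led _ (utau n).
        by rewrite /w; case: ifPn => ?; apply/andP; split; lra.
      by apply/andP; split; lra.
    apply: cvg_trans Tw; apply: near_eq_cvg; exists n0 => // m /un /= /ltW rum.
    by rewrite /k /w itv_mem r0 rum.
  - apply: aeW => r n _; rewrite /= lee_fin normr_id.
    by apply: le_trans (ler_normB _ _) _; apply: lerD; exact: kbound.
  by move=> _ _; rewrite integral0.
have WE n : ((`|convolution T v (u n) - convolution T v t|)%:E <= E n)%E.
  have ext a : 0 <= a <= tau -> is_bochner_integral mu `[0, tau]
      (fun r => if r \in `[0, a]%classic then T (a - r) (v r) else 0) (convolution T v a).
    move=> atau; apply: bochner_extension => //; first exact: itv_finite.
      by apply: subtau; case/andP: atau.
    by apply: bochner_integralP => //; [exact: itv_finite|exact: convolution_integrable].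
  have muD := itv_finite 0 tau.
  apply: le_trans (bochner_dist _ muD (ext _ (utau n)) (ext _ ttau)) _ => //.
  apply: (ge0_le_integral_ae mN) => // r Dr Nr; rewrite lee_fin /k.
  by rewrite !gv.
apply/cvgrPdist_lt => e e0.
have : nbhs (0 : \bar R)%E [set x | (x < e%:E)%E] by apply: open_ereal_lt'; rewrite lte_fin.
move=> /E0[n _ H]; exists n => // m /H /= Em; rewrite distrC -lte_fin.
exact: le_lt_trans (WE m) Em.
Qed.

End integrable_input.

(** The integrands agree before [a], so that only [[a, t]] contributes. The case [a = 0] serves the
    contraction, and the general case the advance by successive intervals. *)
Lemma convolution_dist (tau : R) (v v' : R -> X) (a c t : R) : tau <= d ->
  strongly_measurable mu `[0, tau] v -> strongly_measurable mu `[0, tau] v' ->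
  (\int[mu]_(t in `[0%R, tau]) (`|v t|)%:E < +oo)%E ->
  (\int[mu]_(t in `[0%R, tau]) (`|v' t|)%:E < +oo)%E ->
  0 <= c -> 0 <= a <= t -> t <= tau ->
  (forall s, 0 <= s <= t -> `|v s - v' s| <= c) ->
  (forall s, 0 <= s < a -> v s = v' s) ->
  `|convolution T v t - convolution T v' t| <= M * c * (t - a).
Proof.
move=> taud mv mv' iv iv' c0 /andP[a0 at_] ttau vc va.
have t0 : 0 <= t by exact: le_trans at_.
have ttau' : 0 <= t <= tau by rewrite t0.
have muD := itv_finite 0 t.
rewrite -lee_fin; apply: le_trans (bochner_dist _ muD
  (bochner_integralP _ muD (convolution_integrable taud mv iv ttau'))
  (bochner_integralP _ muD (convolution_integrable taud mv' iv' ttau'))) _ => //.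
have Mc : 0 <= M * c by exact: mulr_ge0.
apply: (@le_trans _ _ (\int[mu]_(s in `[0%R, t]) ((M * c)%:E * (\1_(`[a, t]%classic) s)%:E))%E).
  apply: ge0_le_integral_nomeas => // s; rewrite /= in_itv /= => /andP[s0 st].
  rewrite -EFinM lee_fin indicE itv_mem st andbT.
  have [as_|sa] := leP a s; last first.
    by rewrite va ?s0// subrr normr0 mulr0.
  rewrite mulr1 -semigroupB ?subr_ge0//.
  apply: le_trans (T_bound _ _) _; first by apply/andP; split; lra.
  by apply: ler_wpM2l => //; apply: vc; rewrite s0.
rewrite (@ge0_integralZl_EFin _ _ _ mu _ _ (fun s => (\1_(`[a, t]%classic) s)%:E))//; last first.
  by apply/measurable_EFinP; exact: measurable_indic.
rewrite integral_indic// setIidl; last first.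
  by move=> s; rewrite /= !in_itv /= => /andP[as_ ->]; rewrite (le_trans a0).
have := lebesgue_measure_itv `[a, t] => /= ->; rewrite lte_fin.
case: ifPn => [_|]; first by rewrite -EFinB -EFinM.
rewrite -leNgt => ta; have -> : t = a by apply/eqP; rewrite eq_le ta.
by rewrite mule0 subrr mulr0.
Qed.

End convolution.

(** * Inputs in Lp *)

Section input_bound.
Context (R : realType) (U : normedModType R).
Local Notation mu := (@lebesgue_measure R).

(* Young's inequality [a <= c + c^(1-p) a^p] replaces Hoelder's. *)
Lemma Lp_ball_L1_small (p rho e : R) : 1 < p -> 0 < rho -> 0 < e ->
  exists tau0 : R, 0 < tau0 /\ forall tau u, 0 < tau <= tau0 -> @U_ad R U p tau rho u ->
    (\int[mu]_(t in `[0%R, tau]) (`|u t|)%:E <= e%:E)%E.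
Proof.
move=> p1 rho0 e0.
have p10 : 0 < p - 1 by lra.
have p0 : 0 < p by lra.
(* With this [k] the power term integrates to at most [k^-1 * rho^p = e / 2]; [c] is then fixed by
   [c^(p-1) = k]. *)
pose k := 2 * rho `^ p / e.
have k0 : 0 < k by rewrite divr_gt0// mulr_gt0// powR_gt0.
pose c := k `^ (p - 1)^-1.
have c0 : 0 < c by exact: powR_gt0.
have ck : c `^ (p - 1) = k by rewrite -powRrM mulVf ?gt_eqF// powRr1// ltW.
(* Beyond [c] one has [a^(p-1) >= k], hence [a <= k^-1 * a^p]. *)
have young a : 0 <= a -> a <= c + k^-1 * a `^ p.
  move=> a0; have [ac|/ltW ca] := leP a c.
    by apply: le_trans ac _; rewrite lerDl mulr_ge0// ?powR_ge0// invr_ge0 ltW.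
  rewrite -mulr_powRB1//; apply: ler_wpDl; first exact: ltW.
  rewrite mulrCA; apply: ler_peMr => //; rewrite mulrC ler_pdivlMr// mul1r -ck.
  by apply: ge0_ler_powR => //; rewrite ?nnegrE ltW.
(* On an interval of at most this length the constant [c] contributes the other [e / 2]. *)
exists (e / (2 * c)); split; first by rewrite divr_gt0// mulr_gt0.
move=> tau u /andP[tau0 taue] [[mu_ _] uR].
have [N [g [s [mN N0 ss sg gu]]]] := strongly_measurable_regularize mu_.
have mD : measurable (`[0, tau]%classic : set R) by [].
have mg : measurable_fun (`[0, tau]%classic : set R) (fun r => `|g r|).
  exact: (simple_limit_measurable_norm ss sg).
have mgp : measurable_fun (`[0, tau]%classic : set R) (fun r => `|g r| `^ p).
  exact: (measurableT_comp (measurable_powR p) mg).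
have up : (\int[mu]_(t in `[0%R, tau]) (`|u t| `^ p)%:E <= (rho `^ p)%:E)%E.
  set J := (X in (X <= _)%E).
  have J0 : (0 <= J)%E by apply: integral_ge0 => t _; rewrite lee_fin powR_ge0.
  have -> : J = ((J `^ p^-1) `^ p)%E.
    by rewrite -poweRrM mulVf ?gt_eqF// poweRe1.
  rewrite -poweR_EFin; apply: gt0_ler_poweR => //; first exact: ltW.
  - by rewrite in_itv /= leey andbT poweR_ge0.
  - by rewrite in_itv /= leey andbT lee_fin ltW.
apply: (@le_trans _ _ (\int[mu]_(t in `[0%R, tau]) (`|g t|)%:E)%E).
  by apply: (ge0_le_integral_ae mN) => // t Dt Nt; rewrite gu.
apply: (@le_trans _ _ (\int[mu]_(t in `[0%R, tau]) (c%:E + k^-1%:E * (`|g t| `^ p)%:E))%E).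
  apply: ge0_le_integral_nomeas => // t _.
  by rewrite -EFinM -EFinD lee_fin young.
rewrite ge0_integralD//; last 3 first.
- by move=> t _; rewrite lee_fin ltW.
- by move=> t _; rewrite -EFinM lee_fin mulr_ge0 ?powR_ge0// invr_ge0 ltW.
- by apply: emeasurable_funM => //; exact/measurable_EFinP.
rewrite (integral_cst mu mD c%:E).
rewrite (@ge0_integralZl_EFin _ _ _ mu _ _ (fun r => (`|g r| `^ p)%:E))//; last 2 first.
- exact/measurable_EFinP.
- by rewrite invr_ge0 ltW.
have muD : (mu `[0%R, tau] = tau%:E)%E.
  by rewrite lebesgue_measure_itv /= lte_fin tau0 -EFinB subr0.
rewrite [X in (_ * X + _)%E](_ : _ = tau%:E); last exact: muD.
have -> : e = e / 2 + e / 2 by rewrite -splitr.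
rewrite EFinD; apply: leeD.
  rewrite -EFinM lee_fin mulrC -ler_pdivlMr//.
  by apply: le_trans taue _; rewrite invfM mulrA.
apply: (@le_trans _ _ (k^-1%:E * (rho `^ p)%:E)%E).
  apply: lee_wpmul2l; first by rewrite lee_fin invr_ge0 ltW.
  apply: le_trans up; apply: (ge0_le_integral_ae mN) => //.
  - by move=> t Dt Nt; rewrite gu.
rewrite -EFinM lee_fin /k invf_div -mulrA mulrC.
have : rho `^ p != 0 by rewrite gt_eqF ?powR_gt0.
by move=> r0; rewrite le_eqVlt; apply/orP; left; apply/eqP; field.
Qed.

End input_bound.

Section bounded_linear_comp.
Context (R : realType) (V W : normedModType R) (f : V -> W) (C : R).
Hypotheses (lf : linear f) (fC : forall x, `|f x| <= C * `|x|).

Lemma bounded_linear_strongly_measurable d (T : measurableType d)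
    (mu : {measure set T -> \bar R}) (D : set T) (u : T -> V) :
  strongly_measurable mu D u -> strongly_measurable mu D (f \o u).
Proof.
move=> /strongly_measurableP[N [s [mN N0 ss su]]].
apply/strongly_measurableP; exists N, (fun n => f \o s n); split => //.
  by move=> n; exact: is_simple_comp.
move=> t Dt Nt; apply/cvgrPdist_lt => e e0 /=.
(* The sign of [C] is unknown, hence a positive constant above it. *)
have C1 : 0 < `|C| + 1 by rewrite ltr_wpDl.
have e' : 0 < e / (`|C| + 1) by rewrite divr_gt0.
near=> n.
rewrite -linear_subr//; apply: le_lt_trans (fC _) _.
apply: (@le_lt_trans _ _ ((`|C| + 1) * `|u t - s n t|)).
  by apply: ler_wpM2r => //; apply: le_trans (ler_norm _) _; rewrite lerDl.
rewrite mulrC -ltr_pdivlMr//.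
by near: n; apply: cvgr_dist_lt => //; exact: su.
Unshelve. all: by end_near. Qed.

End bounded_linear_comp.

(** * The Volterra equation *)

(** [g] gathers the terms free of the unknown: the free evolution of the initial state and the
    response to the input. *)
Definition volterra_map (R : realType) (X : normedModType R) (T : R -> X -> X)
    (F : X -> X) (g x : R -> X) (t : R) : X := g t + convolution T (F \o x) t.

Lemma mild_solutionP (R : realType) (X U : normedModType R) (T : R -> X -> X)
    (F : X -> X) (b : U -> X) (u : R -> U) (x0 : X) (tau : R) (x : R -> X) :
  mild_solution T F b u x0 tau x <->
  {within `[0, tau], continuous x} /\ forall t, 0 <= t <= tau ->
    [/\ bochner_integrable lebesgue_measure `[0, t] (fun s => T (t - s) ((F \o x) s)),
        bochner_integrable lebesgue_measure `[0, t] (fun s => T (t - s) ((b \o u) s))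
      & x t = volterra_map T F (fun s => T s x0 + convolution T (b \o u) s) x t].
Proof.
split=> -[cx H]; (split; first exact: cx) => t /H[i1 i2 xE].
  by split; [exact: i1|exact: i2|rewrite xE; exact: addrAC].
by split; [exact: i1|exact: i2|rewrite xE; exact: addrAC].
Qed.

Section volterra.
Context (R : realType) (X : completeNormedModType R) (T : R -> X -> X) (F : X -> X).
Hypothesis semigroup_T : C0_semigroup T.
Variables (d M tau : R) (g : R -> X).
Hypotheses (M_ge1 : 1 <= M)
  (T_bound : forall t x, 0 <= t <= d -> `|T t x| <= M * `|x|)
  (F_0 : F 0 = 0) (F_lipschitz : locally_lipschitz F)
  (tau_gt0 : 0 < tau) (tau_le : tau <= d)
  (cont_g : {within `[0, tau], continuous g}).
Local Notation mu := (@lebesgue_measure R).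

Let M_ge0 : 0 <= M. Proof. exact: le_trans M_ge1. Qed.

Let itvP (s : R) : `[0, tau]%classic s <-> 0 <= s <= tau.
Proof. by rewrite /= in_itv. Qed.

Lemma locally_lipschitz_cvg (u : nat -> X) (x : X) :
  u n @[n --> \oo] --> x -> F (u n) @[n --> \oo] --> F x.
Proof.
move=> ux; have [|L [L0 HL]] := F_lipschitz (delta := `|x| + 1).
  by rewrite ltr_wpDl.
apply/cvgrPdist_lt => e e0; near=> n.
have un : `|x - u n| < e / L by near: n; apply: cvgr_dist_lt => //; rewrite divr_gt0.
have un1 : `|x - u n| < 1 by near: n; exact: cvgr_dist_lt.
apply: le_lt_trans (HL _ _ _ _) _; last by rewrite mulrC -ltr_pdivlMr.
  rewrite -[u n](subrKC x) (le_trans (ler_normD _ _))// lerD2l.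
  by rewrite distrC ltW.
by rewrite lerDl.
Unshelve. all: by end_near. Qed.

Lemma within_continuous_bounded (x : R -> X) : {within `[0, tau], continuous x} ->
  exists C : R, 0 < C /\ forall s, 0 <= s <= tau -> `|x s| <= C.
Proof.
move=> /within_continuous_seqP cx.
have cn : {within `[0, tau], continuous (fun s => `|x s| : R)}.
  apply/within_continuous_seqP => u t ut tt utt.
  by apply: cvg_norm; exact: cx.
have [c _ Hc] := EVT_max (ltW tau_gt0) cn.
(* The [+ 1] makes the bound positive, as Lipschitz constants are given for positive radii. *)
exists (`|x c| + 1); split; first by rewrite ltr_wpDl.
by move=> s sA; apply: le_trans (Hc s _) _; rewrite ?in_itv// lerDl.
Qed.

(** Composing [F] and [x] with the simple approximants of the identity gives simple functions, which
    converge everywhere by continuity. As [F 0 = 0], the norm is at most [L * C], for [C] a bound of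
    [x]. *)
Lemma nonlinear_integrable (x : R -> X) : {within `[0, tau], continuous x} ->
  strongly_measurable mu `[0, tau] (F \o x) /\
  (\int[mu]_(t in `[0%R, tau]) (`|(F \o x) t|)%:E < +oo)%E.
Proof.
move=> cx; split.
  have [q [sq qc]] := interval_simple_approx tau.
  apply/strongly_measurableP; exists set0, (fun n s => F (x (q n s))); split => //.
    by move=> n; exact: (is_simple_comp (F \o x) (sq n)).
  move=> t /itvP tt _; have [qt qct] := qc t tt; have /andP[t0 ttau] := tt.
  apply: locally_lipschitz_cvg.
  have /within_continuous_seqP := cx; apply => //.
  by move=> n; apply/itvP; have /andP[-> /le_trans] := qt n; apply.
have [C [C0 xC]] := within_continuous_bounded cx.
have [L [L0 HL]] := F_lipschitz C0.
apply: (@le_lt_trans _ _ (\int[mu]_(t in `[0%R, tau]) (cst (L * C)%:E) t)%E).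
  apply: ge0_le_integral_nomeas => // t /itvP tt; rewrite lee_fin /=.
  rewrite -[F _]subr0 -F_0; apply: le_trans (HL _ _ _ _) _.
  - by rewrite normr0 ltW.
  - exact: xC.
  - by rewrite subr0 ler_wpM2l ?xC// ltW.
rewrite integral_cst//.
by rewrite lte_mul_pinfty ?lee_fin ?mulr_ge0 ?ltW//; exact: itv_finite.
Qed.

Local Notation volterra_map := (volterra_map T F g).

Lemma volterra_map_continuous (x : R -> X) : {within `[0, tau], continuous x} ->
  {within `[0, tau], continuous (volterra_map x)}.
Proof.
move=> cx; have [mF iF] := nonlinear_integrable cx.
apply/within_continuous_seqP => u t uA tA ut; apply: cvgD.
  by move/within_continuous_seqP : cont_g; exact.
exact: (convolution_cvg semigroup_T M_ge0 T_bound tau_le mF iF).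
Qed.

Lemma volterra_map_dist (x y : R -> X) (delta L c a t : R) :
  {within `[0, tau], continuous x} -> {within `[0, tau], continuous y} ->
  0 <= L -> 0 <= c -> 0 <= a <= t -> t <= tau ->
  (forall x1 x2, `|x1| <= delta -> `|x2| <= delta -> `|F x2 - F x1| <= L * `|x2 - x1|) ->
  (forall s, 0 <= s <= tau -> `|x s| <= delta) ->
  (forall s, 0 <= s <= tau -> `|y s| <= delta) ->
  (forall s, 0 <= s <= t -> `|x s - y s| <= c) ->
  (forall s, 0 <= s < a -> x s = y s) ->
  `|volterra_map x t - volterra_map y t| <= M * (L * c) * (t - a).
Proof.
move=> cx cy L0 c0 at_ ttau HL xd yd xyc xya.
have [mx ix] := nonlinear_integrable cx; have [my iy] := nonlinear_integrable cy.
rewrite /volterra_map opprD addrACA subrr add0r.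
apply: (convolution_dist semigroup_T M_ge0 T_bound tau_le) => //.
- exact: mulr_ge0.
- move=> s /andP[s0 st]; have stau : 0 <= s <= tau by rewrite s0 (le_trans st).
  apply: le_trans (HL _ _ (yd _ stau) (xd _ stau)) _.
  by apply: ler_wpM2l => //; apply: xyc; rewrite s0.
- by move=> s sa /=; rewrite xya.
Qed.

Lemma le_geometric_eq0 (x C : R) : 0 <= x -> (forall n : nat, x <= C * 2^-1 ^+ n) -> x = 0.
Proof.
move=> x0 H; apply/eqP; rewrite eq_le x0 andbT.
have : C * 2^-1 ^+ n @[n --> \oo] --> C * 0.
  apply: cvgM; first exact: cvg_cst.
  by apply: cvg_expr; rewrite ger0_norm ?invr_ge0// invf_lt1// ltr1n.
rewrite mulr0 => Hc.
by apply: (ler_cvg_to (cvg_cst x) Hc); exact: nearW.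
Qed.

(** The constant [L] belongs to a ball containing both solutions and may be too large for a
    contraction on the whole of [[0, tau]]; hence the short intervals. *)
Lemma volterra_unique (x y : R -> X) :
  {within `[0, tau], continuous x} -> {within `[0, tau], continuous y} ->
  (forall t, 0 <= t <= tau -> x t = volterra_map x t) ->
  (forall t, 0 <= t <= tau -> y t = volterra_map y t) ->
  forall t, 0 <= t <= tau -> x t = y t.
Proof.
move=> cx cy xE yE.
have [Cx [Cx0 xC]] := within_continuous_bounded cx.
have [Cy [Cy0 yC]] := within_continuous_bounded cy.
pose D := Cx + Cy; have D0 : 0 < D by rewrite addr_gt0.
have xD s : 0 <= s <= tau -> `|x s| <= D by move=> /xC h; rewrite /D; lra.
have yD s : 0 <= s <= tau -> `|y s| <= D by move=> /yC h; rewrite /D; lra.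
have [L [L0 HL]] := F_lipschitz D0.
have ML : 0 < 2 * (M * L) by rewrite !mulr_gt0// (lt_le_trans _ M_ge1).
(* On an interval of length [h] one use of the equation halves the distance, as
   [M * L * h = 1/2]. *)
pose h := (2 * (M * L))^-1.
have h0 : 0 < h by rewrite invr_gt0.
have main (k : nat) t : 0 <= t <= tau -> t < k%:R * h -> x t = y t.
  elim: k t => [|k IH]; first by move=> t /andP[t0 _]; rewrite mul0r ltNge t0.
  (* Given equality before [k * h], the equation is used [j] times on the next interval, starting
     from the crude bound [D + D]. *)
  have bound (j : nat) t : 0 <= t <= tau -> t < k.+1%:R * h ->
      `|x t - y t| <= (D + D) * 2^-1 ^+ j.
    elim: j t => [|j IHj] t tt tk.
      by rewrite expr0 mulr1 (le_trans (ler_normB _ _))// lerD ?xD ?yD.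
    have /andP[t0 ttau] := tt.
    (* The minimum also covers a [t] that lies before [k * h]; in all cases the solutions agree
       before [a] and [t - a <= h]. *)
    pose a := Num.min t (k%:R * h).
    have at_ : 0 <= a <= t.
      rewrite /a le_min t0 ge_min lexx /= andbT.
      by apply: mulr_ge0; [exact: ler0n|exact: ltW].
    rewrite xE// yE//.
    apply: le_trans (@volterra_map_dist x y D L ((D + D) * 2^-1 ^+ j) a t
      cx cy (ltW L0) _ at_ ttau HL xD yD _ _) _.
    - by rewrite mulr_ge0 ?exprn_ge0 ?invr_ge0 ?addr_ge0 ?ltW.
    - move=> s /andP[s0 st]; apply: IHj; first by rewrite s0 (le_trans st).
      exact: le_lt_trans tk.
    - move=> s /andP[s0]; rewrite lt_min => /andP[st sk].
      by apply: IH => //; rewrite s0 (le_trans (ltW st)).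
    have ta : t - a <= h.
      rewrite /a; case: (leP t (k%:R * h)) => [_|kt]; first by rewrite subrr ltW.
      by move: tk; rewrite -natr1 mulrDl mul1r; lra.
    rewrite exprSr [leRHS]mulrA; set c := (D + D) * _.
    have c0 : 0 <= c by rewrite mulr_ge0 ?exprn_ge0 ?invr_ge0 ?addr_ge0 ?ltW.
    apply: (@le_trans _ _ (M * (L * c) * h)).
      by apply: ler_wpM2l => //; rewrite mulr_ge0// mulr_ge0// ltW.
    have -> : M * (L * c) * h = c * 2^-1; last by [].
    by rewrite /h; field; rewrite !gt_eqF// (lt_le_trans _ M_ge1).
  move=> t tt tk; apply/eqP; rewrite -subr_eq0 -normr_eq0; apply/eqP.
  by apply: (@le_geometric_eq0 _ (D + D)) => // j; exact: bound.
move=> t tt; apply: (main (Num.truncn (t / h)).+1) => //.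
by rewrite -ltr_pdivrMr// truncnS_gt.
Qed.

Section existence.
Variables (delta L : R).
Hypotheses (delta_gt0 : 0 < delta) (L_gt0 : 0 < L)
  (F_L : forall x1 x2, `|x1| <= delta -> `|x2| <= delta -> `|F x2 - F x1| <= L * `|x2 - x1|)
  (MLtau : M * L * tau <= 2^-1)
  (g_small : forall t, 0 <= t <= tau -> `|g t| <= delta / 2).

(** The iteration starts from zero, whose image is [g] on [[0, tau]] because [F 0 = 0]. *)
Let picard n : R -> X := iter n volterra_map (cst 0).

Let picardS n : picard n.+1 = volterra_map (picard n). Proof. by []. Qed.

Let cst0_continuous : {within `[0, tau], continuous (cst 0 : R -> X)}.
Proof. by apply/within_continuous_seqP => *; exact: cvg_cst. Qed.

Let convolution0 t : 0 <= t <= tau -> convolution T (F \o cst 0) t = 0.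
Proof.
move=> tt; have [m0 i0] := nonlinear_integrable cst0_continuous.
have := convolution_norm_le semigroup_T M_ge0 T_bound tau_le m0 i0 tt.
under eq_integral do rewrite /= F_0 normr0.
by rewrite integral0 mule0 lee_fin normr_le0 => /eqP.
Qed.

(** The case [a = 0] of [volterra_map_dist], with factor [M * L * tau <= 1/2]. *)
Lemma volterra_contraction (x y : R -> X) c :
  {within `[0, tau], continuous x} -> {within `[0, tau], continuous y} ->
  (forall s, 0 <= s <= tau -> `|x s| <= delta) ->
  (forall s, 0 <= s <= tau -> `|y s| <= delta) -> 0 <= c ->
  (forall s, 0 <= s <= tau -> `|x s - y s| <= c) ->
  forall t, 0 <= t <= tau -> `|volterra_map x t - volterra_map y t| <= c / 2.
Proof.
move=> cx cy xd yd c0 xyc t tt; have /andP[t0 ttau] := tt.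
apply: le_trans (@volterra_map_dist x y delta L c 0 t cx cy (ltW L_gt0) c0 _ ttau F_L xd yd _ _) _.
- by rewrite lexx.
- by move=> s /andP[s0 st]; apply: xyc; rewrite s0 (le_trans st).
- by move=> s /andP[s0]; rewrite ltNge s0.
rewrite subr0; apply: (@le_trans _ _ (M * (L * c) * tau)).
  by apply: ler_wpM2l => //; rewrite !mulr_ge0// ltW.
have -> : M * (L * c) * tau = c * (M * L * tau) by ring.
exact: ler_wpM2l.
Qed.

(** The ball is preserved: the image of zero has norm at most [delta / 2], and by contraction any
    image from the ball lies within [delta / 2] of it. *)
Lemma picardP n : {within `[0, tau], continuous (picard n)} /\
  forall s, 0 <= s <= tau -> `|picard n s| <= delta.
Proof.
elim: n => [|n [cn dn]].
  by split => // s _; rewrite normr0 ltW.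
split; first exact: volterra_map_continuous.
move=> t tt; rewrite picardS.
have := @volterra_contraction (picard n) (cst 0) delta cn cst0_continuous dn _
  (ltW delta_gt0) _ t tt.
have n0 s : 0 <= s <= tau -> `|cst 0 s : X| <= delta by move=> _; rewrite normr0 ltW.
have n1 s : 0 <= s <= tau -> `|picard n s - cst 0 s| <= delta.
  by move=> ss; rewrite subr0; exact: dn.
move=> /(_ n0 n1) h.
rewrite -[volterra_map _ t](subrK (volterra_map (cst 0) t)).
apply: le_trans (ler_normD _ _) _; rewrite [leRHS]splitr; apply: lerD => //.
by rewrite /volterra_map convolution0// addr0 g_small.
Qed.

Lemma picard_dist n k t : 0 <= t <= tau ->
  `|picard (n + k) t - picard n t| <= delta * 2^-1 ^+ n.
Proof.
elim: n t => [|n IH] t tt.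
  by rewrite add0n expr0 mulr1 subr0; have [_] := picardP k; exact.
rewrite exprSr mulrA addSn !picardS.
have [c1 d1] := picardP (n + k); have [c2 d2] := picardP n.
apply: volterra_contraction => //.
by rewrite mulr_ge0 ?exprn_ge0 ?invr_ge0 ?ltW.
Qed.

(** The contraction principle done by hand: the limits are taken pointwise in [X], and the geometric
    rate, uniform in [t], gives both continuity of the limit and the fixed point equation. *)
Lemma volterra_exists : exists x : R -> X, {within `[0, tau], continuous x} /\
  forall t, 0 <= t <= tau -> x t = volterra_map x t.
Proof.
have small e : 0 < e -> \forall n \near \oo, delta * 2^-1 ^+ n < e.
  move=> e0; have : delta * 2^-1 ^+ n @[n --> \oo] --> delta * 0.
    apply: cvgM; first exact: cvg_cst.
    by apply: cvg_expr; rewrite ger0_norm ?invr_ge0// invf_lt1// ltr1n.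
  by rewrite mulr0 => /cvgr_lt; apply.
have lim_picard t : exists l : X, 0 <= t <= tau ->
    picard n t @[n --> \oo] --> l.
  have [tt|ntt] := boolP (0 <= t <= tau); last by exists 0.
  suff /cvg_ex[l Hl] : cvgn (fun n => picard n t) by exists l.
  suff : cauchy ((fun n => picard n t) @ \oo) by exact: cauchy_cvg.
  suff : cauchy_ex ((fun n => picard n t) @ \oo) by exact: cauchy_exP.
  move=> r r0; have [n _ Hn] := small r r0.
  exists (picard n t); exists n => // m /= nm.
  rewrite -ball_normE /= distrC -(subnKC nm).
  by apply: le_lt_trans (picard_dist _ _ tt) _; exact: Hn (leqnn n).
have [x Hx] := choice lim_picard.
have xd n t : 0 <= t <= tau -> `|x t - picard n t| <= delta * 2^-1 ^+ n.
  move=> tt; apply: (@ler_cvg_to _ \oo _ _ (fun k => `|picard (n + k) t - picard n t|)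
    (cst (delta * 2^-1 ^+ n))).
  - apply: cvg_norm; apply: cvgB; last exact: cvg_cst.
    have := Hx t tt; rewrite -(@cvg_shiftn n _ (fun k => picard k t)) /= => h.
    by under eq_fun do rewrite addnC.
  - exact: cvg_cst.
  - by apply: nearW => k; exact: picard_dist.
(* The three-epsilon argument, with one iterate uniformly close to [x]. *)
have cx : {within `[0, tau], continuous x}.
  apply/within_continuous_seqP => u t uA tA ut; apply/cvgrPdist_lt => e e0.
  have [n _ /(_ n (leqnn n)) /= Hn] := small (e / 3) (divr_gt0 e0 (ltr0Sn R 2)).
  have [/within_continuous_seqP cn _] := picardP n.
  have := cn u t uA tA ut => /cvgrPdist_lt /(_ (e / 3) (divr_gt0 e0 (ltr0Sn R 2))) [n0 _ H].
  exists n0 => // m /H /= Hm.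
  apply: le_lt_trans (ler_distD (picard n t) _ _) _.
  have := xd n t (proj1 (itvP t) tA).
  have := xd n (u m) (proj1 (itvP _) (uA m)).
  have := ler_distD (picard n (u m)) (picard n t) (x (u m)).
  rewrite [X in _ <= _ + X -> _]distrC; lra.
exists x; split => // t tt.
have xdelta s : 0 <= s <= tau -> `|x s| <= delta.
  by move=> ss; have := xd 0%N s ss; rewrite subr0 expr0 mulr1.
apply/eqP; rewrite -subr_eq0 -normr_eq0; apply/eqP.
apply: (@le_geometric_eq0 _ (delta + delta)) => // n.
have [cn dn] := picardP n.
(* The iterate [n + 1] is close to [x] by the rate, and close to the image of [x] by contraction
   from the iterate [n]. *)
apply: le_trans (ler_distD (picard n.+1 t) _ _) _; rewrite mulrDl; apply: lerD.
  apply: le_trans (xd n.+1 t tt) _; rewrite exprS.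
  apply: ler_wpM2l; first exact: ltW.
  by apply: ler_piMl; rewrite ?exprn_ge0 ?invr_ge0// invf_le1// ler1n.
have e0 : 0 <= delta * 2^-1 ^+ n by rewrite mulr_ge0 ?exprn_ge0 ?invr_ge0 ?ltW.
have := @volterra_contraction (picard n) x (delta * 2^-1 ^+ n) cn cx dn xdelta e0 _ t tt.
rewrite -picardS => h; apply: le_trans (h _) _.
  by move=> s ss; rewrite distrC; exact: xd.
by rewrite ler_pdivrMr// ler_peMr// ler1n.
Qed.

End existence.
End volterra.

(** * Choice of the time and conclusion *)

Theorem theorem3p1 (R : realType) (X U : completeNormedModType R)
  (K : topologicalType) (K_ad : set K) (p : R)
  (DA : set X) (A : X -> X) (T : R -> X -> X) (F : X -> X) (B : K -> U -> X)
  (X_separable : separable_space X) (X_reflexive : reflexive_space X)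
  (U_reflexive : reflexive_space U)
  (p_gt1 : 1 < p)
  (A_generates_T : generates DA A T)
  (F_0 : F 0 = 0) (F_lipschitz : locally_lipschitz F)
  (B_bounded_linear : forall r, K_ad r -> bounded_linear (B r))
  (B_bound : exists M : R, 0 < M /\ forall r, K_ad r -> opnorm (B r) <= M) :
  forall (x0 : X) (rho : R), 0 < rho ->
  exists tau : R, 0 < tau /\
    forall u : R -> U, U_ad p tau rho u -> forall r : K, K_ad r ->
      exists x : R -> X, mild_solution T F (B r) u x0 tau x /\
        forall y : R -> X, mild_solution T F (B r) u x0 tau y ->
          forall t : R, 0 <= t <= tau -> y t = x t.
Proof.
move=> x0 rho rho0; have [sT _ _] := A_generates_T.
have [d [M [d0 M1 TM]]] := C0_semigroup_locally_bounded sT.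
have [MB [MB0 BM]] := B_bound.
have M0 : 0 < M by exact: lt_le_trans M1.
(* Twice the bound for [g]: [M * |x0|] from the free evolution and 1 from the input. *)
pose delta := 2 * (M * `|x0| + 1).
have delta0 : 0 < delta.
  by rewrite mulr_gt0// ltr_wpDl// mulr_ge0// ltW.
have [L [L0 HL]] := F_lipschitz delta delta0.
(* An input of this L^1 norm gives a convolution of norm at most [M * MB * (M * MB)^-1 = 1]. *)
have MMB0 : 0 < (M * MB)^-1 by rewrite invr_gt0 mulr_gt0.
have [tau0 [tau00 Htau0]] := @Lp_ball_L1_small R U p rho _ p_gt1 rho0 MMB0.
have ML0 : 0 < M * L by exact: mulr_gt0.
(* The three constraints are the semigroup bound, the smallness of the input and the contraction
   factor 1/2; none depends on [u] or [r]. *)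
pose tau := Num.min d (Num.min tau0 (2 * (M * L))^-1).
have tau_gt0 : 0 < tau by rewrite !lt_min d0 tau00 invr_gt0 mulr_gt0.
have taud : tau <= d by rewrite ge_min lexx.
have tautau0 : 0 < tau <= tau0 by rewrite tau_gt0 !ge_min lexx orbT.
have MLtau : M * L * tau <= 2^-1.
  rewrite mulrC -ler_pdivlMr// -invfM.
  by rewrite /tau !ge_min lexx !orbT.
exists tau; split => // u uU r Kr.
have Bbound z : `|B r z| <= MB * `|z|.
  apply: le_trans (le_opnorm (B_bounded_linear r Kr) z) _.
  by rewrite ler_wpM2r// BM.
have [linB _] := B_bounded_linear r Kr.
have [[mu_ _] _] := uU.
have mBu := bounded_linear_strongly_measurable linB Bbound mu_.
have iBu : (\int[@lebesgue_measure R]_(t in `[0%R, tau]) (`|(B r \o u) t|)%:E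
    <= (M^-1)%:E)%E.
  apply: le_trans (@strongly_measurable_integralZ _ _ _ _ u (B r \o u) MB _
    (ltW MB0) mu_ (fun t _ => Bbound (u t))) _ => //.
  apply: (@le_trans _ _ (MB%:E * (M * MB)^-1%:E)%E).
    by apply: lee_wpmul2l; [rewrite lee_fin ltW|exact: Htau0].
  by rewrite -EFinM lee_fin invfM mulrCA mulfV ?mulr1// gt_eqF.
have fBu : (\int[@lebesgue_measure R]_(t in `[0%R, tau]) (`|(B r \o u) t|)%:E < +oo)%E.
  by apply: le_lt_trans iBu _; rewrite ltry.
pose g t := T t x0 + convolution T (B r \o u) t.
have cg : {within `[0, tau], continuous g}.
  apply/within_continuous_seqP => v t vA tA vt; apply: cvgD.
    apply: (semigroup_cvg sT (ltW M0) TM) => //; last exact: cvg_cst.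
      by move=> n; have := vA n; rewrite /= in_itv /= => /andP[-> /le_trans]; apply.
    by move: tA; rewrite /= in_itv /= => /andP[-> /le_trans]; apply.
  exact: (convolution_cvg sT (ltW M0) TM taud mBu fBu).
have gsmall t : 0 <= t <= tau -> `|g t| <= delta / 2.
  move=> tt; have -> : delta / 2 = M * `|x0| + 1 by rewrite /delta mulrC mulKf.
  apply: le_trans (ler_normD _ _) _; apply: lerD.
    by apply: TM; case/andP: tt => -> /le_trans; apply.
  rewrite -lee_fin; apply: le_trans (convolution_norm_le sT (ltW M0) TM taud mBu fBu tt) _.
  apply: (@le_trans _ _ (M%:E * (M^-1)%:E)%E).
    by apply: lee_wpmul2l => //; rewrite lee_fin ltW.
  by rewrite -EFinM lee_fin mulfV// gt_eqF.
have [x [cx xE]] := volterra_exists sT M1 TM F_0 F_lipschitz tau_gt0 taud cg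
  delta0 L0 HL MLtau gsmall.
exists x; split.
  have [mF iF] := nonlinear_integrable F_0 F_lipschitz tau_gt0 cx.
  apply/mild_solutionP; split => // t tt; split.
  - exact: (convolution_integrable sT (ltW M0) TM taud mF iF tt).
  - exact: (convolution_integrable sT (ltW M0) TM taud mBu fBu tt).
  - exact: xE.
move=> y /mild_solutionP[cy yE] t tt.
have yV s : 0 <= s <= tau -> y s = volterra_map T F g y s.
  by move=> /yE[_ _].
exact: (volterra_unique sT M1 TM F_0 F_lipschitz tau_gt0 taud cy cx yV xE).
Qed.
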